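(* Let $M$ be a closed connected smooth Riemannian manifold, and let $\mathcal{M}$ be the space of all smooth Riemannian metrics on $M$. Then $\mathcal{M}$ has the structure of a bounded Fréchet manifold. Furthermore, $\mathcal{M}$ is an $MC^{\infty}$-Fréchet manifold.
   Context: Closed means compact without boundary. $\mathcal{M}$ is the set of smooth sections of the bundle of symmetric $(0,2)$-tensors on $M$ that are positive definite at every point. Standard metrics. The topology of every Fréchet space is taken to be defined by a complete translation-invariant metric with absolutely convex balls (a standard metric); every Fréchet space admits one. The groups $\mathcal{L}_{g,d}(E,F)$. For Fréchet spaces $(E,g)$ and $(F,d)$, let $\mathcal{L}_{g,d}(E,F)$ be the set of all linear maps $L:E\to F$ such that $$\mathrm{Lip}(L)_{g,d}:=\sup_{x\in E\setminus\{0\}}\frac{d(L(x),0)}{g(x,0)}<\infty ,$$ equipped with the translation-invariant metric $D_{g,d}(L,H)=\mathrm{Lip}(L-H)_{g,d}$, which makes it an Abelian topological group. Let $\mathcal{L}_{g,d}(E,F)_0$ be the connected component of the zero map; with the metric $D_{g,d}$ it is regarded as a Fréchet space. Keller-differentiability. Let $U\subseteq E$ be open and $P:U\to F$ continuous. $P$ is differentiable at $p\in U$ if the directional derivative $\mathrm{d}P(p)h$ exists for all $h\in E$. $P$ is Keller-differentiable if it is differentiable at all points of $U$, the map $\mathrm{d}P:U\to CL(E,F)$ is continuous, where $CL(E,F)$ is the space of continuous linear maps with the compact-open topology, and the map $P':U\times E\to F$, $(u,h)\mapsto \mathrm{d}P(u)h$, is continuous in the product topology. $MC^k$-maps. $P$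 is bounded differentiable if it is Keller-differentiable, $\mathrm{d}P(p)\in\mathcal{L}_{g,d}(E,F)$ for all $p\in U$, and the map $\mathrm{d}P:U\to\mathcal{L}_{g,d}(E,F)$ is continuous. $P$ is $MC^0$ if it is continuous, and $MC^1$ if it is bounded differentiable. For $k\ge 2$, $P$ is $MC^k$ if it is $MC^1$ and each $x_0\in U$ has a connected open neighborhood $V\subseteq U$ such that the map $\mathrm{d}P|_V-\mathrm{d}P(x_0):V\to\mathcal{L}_{g,d}(E,F)_0$ is $MC^{k-1}$. $P$ is $MC^\infty$ if it is $MC^k$ for all $k\in\mathbb{N}_0$. $MC^k$-Fréchet manifolds. An $MC^k$-Fréchet manifold ($k\in\mathbb{N}\cup\{\infty\}$), also called a bounded Fréchet manifold, is defined in the usual way: a Hausdorff space with an atlas of charts that are homeomorphisms onto open subsets of Fréchet spaces (with fixed standard metrics), all of whose coordinate transition functions are $MC^k$-maps. *)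

(* Defs.v *)
From HB Require Import structures.
From mathcomp Require Import all_boot all_order all_algebra.
From mathcomp Require Import all_classical all_reals all_analysis.

Set Implicit Arguments.
Unset Strict Implicit.
Unset Printing Implicit Defensive.

Import Order.TTheory GRing.Theory Num.Theory.
Import numFieldNormedType.Exports.

Local Open Scope classical_set_scope.
Local Open Scope ring_scope.

Definition absolutely_convex (R : realType) (E : lmodType R) (A : set E) :=
  forall (a b : R) x y, `|a| + `|b| <= 1 -> A x -> A y -> A (a *: x + b *: y).

(* A Frechet space with a fixed standard metric. Local convexity is implied by
   [fball_convex] and [fnbhsE]; balls centered elsewhere are translates. *)
Record frechet (R : realType) := Frechet {
  fspace :> topologicalLmodType R;
  fdist : fspace -> fspace -> R;
  fdistxx : forall x, fdist x x = 0;
  fdist_eq : forall x y, fdist x y = 0 -> x = y;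
  fdist_sym : forall x y, fdist x y = fdist y x;
  fdist_triangle : forall y x z, fdist x z <= fdist x y + fdist y z;
  fdistD2r : forall z x y, fdist (x + z) (y + z) = fdist x y;
  fball_convex : forall r : R, absolutely_convex [set x | fdist x 0 < r];
  fnbhsE : forall x : fspace, nbhs x =
    filter_from [set e : R | 0 < e] (fun e => [set y | fdist x y < e]);
  fcomplete : forall u : nat -> fspace,
    (forall e : R, 0 < e -> exists N, forall m n,
       (N <= m)%N -> (N <= n)%N -> fdist (u m) (u n) < e) ->
    exists l : fspace, u @ \oo --> l
}.

Section FrechetTheory.
Context {R : realType} (E : frechet R).
Implicit Types x y : E.

Lemma fdist_ge0 x y : 0 <= fdist x y.
Proof.
by rewrite -(@pmulrn_lge0 _ _ 2)// -(fdistxx x) (le_trans (fdist_triangle y _ _))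
  // (fdist_sym y) mulr2n.
Qed.

Lemma fdist_gt0 x y : (0 < fdist x y) = (x != y).
Proof.
rewrite lt_neqAle fdist_ge0 andbT eq_sym; congr (~~ _).
by apply/eqP/eqP => [/fdist_eq//|->]; rewrite fdistxx.
Qed.

Lemma fdistB x y : fdist x y = fdist (x - y) 0.
Proof. by rewrite -(fdistD2r (- y)) subrr. Qed.

Lemma fdistD x y : fdist (x + y) 0 <= fdist x 0 + fdist y 0.
Proof.
rewrite (le_trans (fdist_triangle y _ _))// lerD2r.
by rewrite -[X in fdist _ X]add0r fdistD2r.
Qed.

Lemma fdistN x : fdist (- x) 0 = fdist x 0.
Proof. by rewrite fdist_sym fdistB opprK add0r. Qed.

Lemma fdist_conv (a b : R) x y : `|a| + `|b| <= 1 ->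
  fdist (a *: x + b *: y) 0 <= Num.max (fdist x 0) (fdist y 0).
Proof.
move=> ab; apply/ler_addgt0Pl => e e0; apply: ltW.
by apply: fball_convex => //=; rewrite ltr_pwDl// le_max lexx ?orbT.
Qed.

Lemma fdistZ1 (t : R) x : `|t| <= 1 -> fdist (t *: x) 0 <= fdist x 0.
Proof.
by have := @fdist_conv t 0 x x; rewrite scale0r maxxx normr0 !addr0.
Qed.

Lemma fdistZn (n : nat) (t : R) x : `|t| <= n%:R ->
  fdist (t *: x) 0 <= n%:R * fdist x 0.
Proof.
have H m : fdist (m%:R *: x) 0 <= m%:R * fdist x 0.
  elim: m => [|m IH]; first by rewrite scale0r mul0r fdistxx.
  rewrite -natr1 scalerDl mulrDl scale1r mul1r.
  by rewrite (le_trans (fdistD _ _))// lerD2r.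
case: n => [|n] tn.
  by move: tn; rewrite normr_le0 => /eqP ->; rewrite scale0r mul0r fdistxx.
have -> : t *: x = (t / n.+1%:R) *: (n.+1%:R *: x) by rewrite scalerA divfK.
rewrite (le_trans (fdistZ1 _ _))// normf_div normr_nat ler_pdivrMr//.
by rewrite mul1r.
Qed.

End FrechetTheory.

Section LipHom.
Context {R : realType} (E F : frechet R).

Definition lip_quot (L : E -> F) : set R :=
  [set fdist (L x) 0 / fdist x 0 | x in [set x | x != 0]].

Definition lip_linear (L : E -> F) : Prop := linear L /\ has_ubound (lip_quot L).

Definition lip_linear_pred : {pred E -> F} := fun L => `[< lip_linear L >].

(* If [E] is trivial the supremum is taken over the empty set and is 0. *)
Definition Lip (L : E -> F) : R := sup (lip_quot L).

Lemma Lip_le (L : E -> F) c : 0 <= c -> L 0 = 0 ->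
  (forall x, fdist (L x) 0 <= c * fdist x 0) ->
  has_ubound (lip_quot L) /\ Lip L <= c.
Proof.
move=> c0 L0 Lc.
have ub : ubound (lip_quot L) c.
  by move=> _ [x /= x0 <-]; rewrite ler_pdivrMr ?fdist_gt0.
split; first by exists c.
by rewrite /Lip; have [->|/set0P ne] := eqVneq (lip_quot L) set0;
  [rewrite sup0|exact: ge_sup].
Qed.

Lemma le_Lip (L : E -> F) x : lip_linear L ->
  fdist (L x) 0 <= Lip L * fdist x 0.
Proof.
move=> [Ll Lu]; have [->|x0] := eqVneq x 0.
  have -> : L 0 = 0.
    by have := Ll (-1) 0 0; rewrite scaleN1r oppr0 addr0 scaleN1r addNr.
  by rewrite !fdistxx mulr0.
rewrite -ler_pdivrMr ?fdist_gt0//; apply: ub_le_sup => //.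
by exists x.
Qed.

Lemma Lip_ge0 (L : E -> F) : 0 <= Lip L.
Proof.
rewrite /Lip; have [->|/set0P [r Lr]] := eqVneq (lip_quot L) set0.
  by rewrite sup0.
have [u|u] := pselect (has_ubound (lip_quot L)); last first.
  by rewrite sup_out// => -[].
apply: (@le_trans _ _ r); last exact: ub_le_sup.
by case: Lr => x _ <-; rewrite divr_ge0// fdist_ge0.
Qed.

Lemma lip_linear0 (L : E -> F) : linear L -> L 0 = 0.
Proof.
by move=> Ll; have := Ll (-1) 0 0; rewrite scaleN1r oppr0 addr0 scaleN1r addNr.
Qed.

Lemma lip_linear_submod : submod_closed lip_linear_pred.
Proof.
split=> [|a f g /asboolP[fl fu] /asboolP[gl gu]]; apply/asboolP; split.
- by move=> b x y /=; rewrite scaler0 addr0.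
- by case: (@Lip_le 0 0 (lexx 0) erefl) => // x; rewrite fdistxx mul0r.
- move=> b x y; rewrite -[LHS]/(a *: f (b *: x + y) + g (b *: x + y)).
  rewrite -[RHS]/(b *: (a *: f x + g x) + (a *: f y + g y)) fl gl.
  by rewrite !scalerDr !scalerA addrACA [b * a]mulrC.
- have [n na] : exists n : nat, `|a| <= n%:R.
    by exists (Num.truncn `|a|).+1; exact/ltW/truncnS_gt.
  case: (@Lip_le (a *: f + g) (n%:R * Lip f + Lip g)) => //.
  + by rewrite addr_ge0 ?mulr_ge0// Lip_ge0.
  + rewrite -[LHS]/(a *: f 0 + g 0) !lip_linear0//.
    by rewrite scaler0 addr0.
  + move=> x; rewrite mulrDl (le_trans (fdistD _ _))// lerD ?le_Lip//.
    by rewrite (le_trans (fdistZn _ na))// -mulrA ler_wpM2l// le_Lip.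
Qed.

HB.instance Definition _ := GRing.isSubmodClosed.Build R (E -> F)
  lip_linear_pred lip_linear_submod.

Record lipHom := LipHom {
  lipfun :> E -> F;
  lipfunP : lipfun \in lip_linear_pred }.

HB.instance Definition _ := [isSub for lipfun].
HB.instance Definition _ := [Choice of lipHom by <:].
HB.instance Definition _ := [SubChoice_isSubLmodule of lipHom by <:].

Implicit Types L H : lipHom.

Lemma lipHomP L : lip_linear L.
Proof. by apply/asboolP; exact: (valP L). Qed.

Lemma lipHom_le L x : fdist (L x) 0 <= Lip L * fdist x 0.
Proof. exact/le_Lip/lipHomP. Qed.

Lemma Lip_lipHom_le L c : 0 <= c ->
  (forall x, fdist (L x) 0 <= c * fdist x 0) -> Lip L <= c.
Proof.
by move=> c0 Lc; apply: (Lip_le c0 _ Lc).2; apply/lip_linear0/(lipHomP L).1.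
Qed.

Lemma LipD L H : Lip (L + H : lipHom) <= Lip L + Lip H.
Proof.
apply: Lip_lipHom_le => [|x]; first by rewrite addr_ge0 ?Lip_ge0.
by rewrite mulrDl (le_trans (fdistD _ _))// lerD// lipHom_le.
Qed.

Lemma LipN L : Lip (- L : lipHom) = Lip L.
Proof.
have H K : Lip (- K : lipHom) <= Lip K.
  by apply: Lip_lipHom_le => [|x]; rewrite ?Lip_ge0// fdistN lipHom_le.
by apply/le_anti; rewrite H -{1}[L]opprK H.
Qed.

Lemma Lip_conv (a b : R) L H : `|a| + `|b| <= 1 ->
  Lip (a *: L + b *: H : lipHom) <= Num.max (Lip L) (Lip H).
Proof.
move=> ab; apply: Lip_lipHom_le => [|x]; first by rewrite le_max Lip_ge0.
rewrite (le_trans (fdist_conv _ _ ab))// maxr_pMl ?fdist_ge0//.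
by rewrite ge_max !le_max !lipHom_le orbT.
Qed.

Lemma LipZn (n : nat) (t : R) L : `|t| <= n%:R -> Lip (t *: L : lipHom) <= n%:R * Lip L.
Proof.
move=> tn; apply: Lip_lipHom_le => [|x]; first by rewrite mulr_ge0 ?Lip_ge0.
by rewrite (le_trans (fdistZn _ tn))// -mulrA ler_wpM2l// lipHom_le.
Qed.

(* The metric D_{g,d}. *)
Definition lip_dist L H : R := Lip (L - H : lipHom).

Fact lip_distxx L : lip_dist L L = 0.
Proof.
apply/le_anti; rewrite Lip_ge0 andbT /lip_dist subrr.
by apply: Lip_lipHom_le => // x; rewrite fdistxx mul0r.
Qed.

Fact lip_dist_eq L H : lip_dist L H = 0 -> L = H.
Proof.
move=> LH0; apply/val_inj/funext => x; apply/fdist_eq/le_anti.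
rewrite fdist_ge0 andbT fdistB.
by have := lipHom_le (L - H) x; rewrite -/(lip_dist L H) LH0 mul0r.
Qed.

Fact lip_dist_sym L H : lip_dist L H = lip_dist H L.
Proof. by rewrite /lip_dist -LipN opprB. Qed.

Fact lip_dist_triangle H L K : lip_dist L K <= lip_dist L H + lip_dist H K.
Proof. by rewrite /lip_dist -(subrKA H) LipD. Qed.

HB.instance Definition _ := isMetric.Build R lipHom
  lip_distxx lip_dist_eq lip_dist_sym lip_dist_triangle.

End LipHom.

Section LipHom0.
Context {R : realType} (E F : frechet R).
Implicit Types L H : lipHom E F.

Definition lip_component : {pred lipHom E F} :=
  fun L => `[< connected_component [set: lipHom E F] 0 L >].

Lemma nbhs_lipHom L (U : set (lipHom E F)) :
  nbhs L U <-> exists2 e : R, 0 < e & forall H, Lip (L - H : lipHom E F) < e -> U H.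
Proof.
by rewrite -nbhs_ballE; split=> -[e /= e0 eU]; exists e.
Qed.

Lemma lipHom_continuous (f : lipHom E F -> lipHom E F) (n : nat) :
  (forall L H, Lip (f L - f H : lipHom E F) <= n%:R * Lip (L - H : lipHom E F)) ->
  continuous f.
Proof.
move=> fn L U /nbhs_lipHom[e e0 eU]; apply/nbhs_lipHom; exists (e / n.+1%:R).
  by rewrite divr_gt0.
move=> H LH; apply: eU; rewrite (le_lt_trans (fn _ _))//.
rewrite ltr_pdivlMr// in LH; apply: le_lt_trans LH.
by rewrite mulrC ler_wpM2l ?Lip_ge0// ler_nat.
Qed.

Lemma lip_component_submod : submod_closed lip_component.
Proof.
pose C := connected_component [set: lipHom E F] 0.
have C0 : C 0 by exact: connected_component_refl.
have CfC (f : lipHom E F -> lipHom E F) : continuous f -> C (f 0) ->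
    forall L, C L -> C (f L).
  move=> cf Cf0 L CL; apply: (connected_component_trans Cf0).
  exists (f @` C).
    split=> //.
    apply: connected_continuous_connected; last exact: continuous_subspaceT.
    exact: component_connected.
  by exists L.
split=> [|a L H /asboolP CL /asboolP CH]; apply/asboolP => //.
have [n na] : exists n : nat, `|a| <= n%:R.
  by exists (Num.truncn `|a|).+1; exact/ltW/truncnS_gt.
apply: (CfC (fun K => a *: K + H)) => //; last by rewrite scaler0 add0r.
apply: (@lipHom_continuous _ n) => K K'.
by rewrite opprD addrACA subrr addr0 -scalerBr LipZn.
Qed.

HB.instance Definition _ := GRing.isSubmodClosed.Build R (lipHom E F)
  lip_component lip_component_submod.

Record lipHom0 := LipHom0 {
  lipHom_of :> lipHom E F;
  lipHom_ofP : lipHom_of \in lip_component }.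

HB.instance Definition _ := [isSub for lipHom_of].
HB.instance Definition _ := [Choice of lipHom0 by <:].
HB.instance Definition _ := [SubChoice_isSubLmodule of lipHom0 by <:].

Definition lip_dist0 (K K' : lipHom0) : R := mdist (\val K) (\val K').

Fact lip_dist0xx K : lip_dist0 K K = 0. Proof. exact: mdistxx. Qed.

Fact lip_dist0_eq K K' : lip_dist0 K K' = 0 -> K = K'.
Proof. by move/mdist_positivity/val_inj. Qed.

Fact lip_dist0_sym K K' : lip_dist0 K K' = lip_dist0 K' K.
Proof. exact: metric_sym. Qed.

Fact lip_dist0_triangle K' K K'' :
  lip_dist0 K K'' <= lip_dist0 K K' + lip_dist0 K' K''.
Proof. exact: metric_triangle. Qed.

HB.instance Definition _ := isMetric.Build R lipHom0
  lip_dist0xx lip_dist0_eq lip_dist0_sym lip_dist0_triangle.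

Implicit Types K : lipHom0.

Lemma lip_dist0E K K' : lip_dist0 K K' = Lip (K - K' : lipHom0).
Proof. by []. Qed.

Lemma lip_component_small L : L \in lip_component -> forall e : R, 0 < e ->
  exists n : nat, Lip (n.+1%:R^-1 *: L : lipHom E F) < e.
Proof.
move=> /asboolP CL e e0.
pose S := [set L' : lipHom E F |
  exists n : nat, Lip (n.+1%:R^-1 *: L' : lipHom E F) < e].
have oS : open S.
  rewrite openE => L1 [n nL1]; apply/nbhs_lipHom.
  exists (e - Lip (n.+1%:R^-1 *: L1 : lipHom E F)); first by rewrite subr_gt0.
  move=> H; rewrite ltrBrDr => LH; exists n.
  rewrite -[H](subKr L1) scalerBr (le_lt_trans (LipD _ _))// LipN.
  apply: le_lt_trans LH; rewrite addrC lerD2r.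
  have := @LipZn _ _ _ 1 n.+1%:R^-1 (L1 - H); rewrite mul1r; apply.
  by rewrite ger0_norm ?invr_ge0// invf_le1// ler1n.
have cS : closed S.
  move=> L1 /(_ [set H | Lip (L1 - H : lipHom E F) < e]).
  have /[swap]/[apply] : nbhs L1 [set H | Lip (L1 - H : lipHom E F) < e].
    by apply/nbhs_lipHom; exists e.
  move=> -[H [[n nH] L1H]]; exists n.+1.
  have -> : n.+2%:R^-1 *: L1 =
      (n.+1%:R / n.+2%:R) *: (n.+1%:R^-1 *: H) + n.+2%:R^-1 *: (L1 - H) :> lipHom E F.
    rewrite scalerA mulrAC divff// mul1r -scalerDr.
    by rewrite addrC subrK.
  apply: (le_lt_trans (Lip_conv _ _ _)).
    rewrite !ger0_norm ?divr_ge0// -[X in _ + X]mul1r -mulrDl natr1 divff//.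
  by rewrite gt_max nH.
have [B [B0 _ cB] BL] := CL.
have : B `&` S = B.
  apply: cB; [exists 0; split => //|by exists S|by exists S].
  exists 0%N; rewrite scaler0.
  have := lip_distxx (0 : lipHom E F).
  by rewrite /lip_dist subrr => ->.
by move=> /setIidPl; apply.
Qed.

Lemma nbhs_lipHom0 K (U : set lipHom0) :
  nbhs K U <-> exists2 e : R, 0 < e & forall K', lip_dist0 K K' < e -> U K'.
Proof.
by rewrite -nbhs_ballE; split=> -[e /= e0 eU]; exists e.
Qed.

Let lipHom0_add_continuous : continuous (fun K : lipHom0 * lipHom0 => K.1 + K.2).
Proof.
move=> [a b] /= U /= /nbhs_lipHom0[e e0 eU].
exists ([set K | lip_dist0 a K < e / 2], [set K | lip_dist0 b K < e / 2]) => /=.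
  by split; apply/nbhs_lipHom0; exists (e / 2); rewrite ?divr_gt0.
move=> [x y] /= [ax bY]; apply: eU => /=.
rewrite lip_dist0E opprD addrACA [ltRHS]splitr.
exact: le_lt_trans (LipD _ _) (ltrD ax bY).
Qed.

Let lipHom0_scale_continuous :
  continuous (fun z : R^o * lipHom0 => z.1 *: z.2).
Proof.
move=> [a b] /= U /= /nbhs_lipHom0[e e0 eU].
have e20 : 0 < e / 2 by rewrite divr_gt0.
have [m mb] := lip_component_small (lipHom_ofP b) e20.
have [n na] : exists n : nat, `|a| + 1 <= n.+1%:R.
  by exists (Num.truncn (`|a| + 1)); apply/ltW/truncnS_gt.
exists (ball (a : R^o) m.+1%:R^-1, [set K | lip_dist0 b K < e / 2 / n.+1%:R]) => /=.
  split; first by apply: nbhsx_ballx; rewrite invr_gt0.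
  by apply/nbhs_lipHom0; exists (e / 2 / n.+1%:R); rewrite ?divr_gt0.
move=> [t y] /=; rewrite -ball_normE /= => -[tm yb]; apply: eU => /=.
rewrite lip_dist0E.
have -> : a *: b - t *: y = (a - t) *: b + t *: (b - y).
  by rewrite scalerBr scalerBl addrA subrK.
apply: le_lt_trans (LipD ((a - t) *: (b : lipHom E F))
  (t *: (b - y : lipHom E F))) _.
rewrite [ltRHS]splitr; apply: ltrD.
  apply: le_lt_trans mb.
  rewrite [X in Lip X](_ : _ = lipfun (((a - t) * m.+1%:R) *:
    (m.+1%:R^-1 *: (b : lipHom E F)))); last first.
    by rewrite scalerA mulfK.
  have := @LipZn _ _ _ 1 ((a - t) * m.+1%:R) (m.+1%:R^-1 *: (b : lipHom E F)).
  rewrite mul1r; apply.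
  by rewrite normrM normr_nat -ler_pdivlMr// mul1r ltW.
have tn : `|t| <= n.+1%:R.
  apply: le_trans na; rewrite -[t](subrK a) (le_trans (ler_normD _ _))//.
  by rewrite addrC lerD2l distrC (le_trans (ltW tm))// invf_le1// ler1n.
apply: le_lt_trans (LipZn _ tn) _.
by rewrite mulrC -ltr_pdivlMr.
Qed.

HB.instance Definition _ :=
  PreTopologicalNmodule_isTopologicalNmodule.Build lipHom0 lipHom0_add_continuous.
HB.instance Definition _ :=
  TopologicalNmodule_isTopologicalLmodule.Build R lipHom0 lipHom0_scale_continuous.

Lemma fdist_cvg (G : frechet R) (u : nat -> G) (l : G) : u @ \oo --> l ->
  forall e : R, 0 < e -> exists N, forall n, (N <= n)%N -> fdist l (u n) < e.
Proof.
move=> ul e e0; have : nbhs l [set y | fdist l y < e].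
  by rewrite fnbhsE; exists e.
by move=> /ul[N _ NP]; exists N => n /NP.
Qed.

Lemma lipHom_complete (u : nat -> lipHom E F) :
  (forall e : R, 0 < e -> exists N, forall m n, (N <= m)%N -> (N <= n)%N ->
     Lip (u m - u n : lipHom E F) < e) ->
  exists L, forall e : R, 0 < e -> exists N, forall n, (N <= n)%N ->
     Lip (L - u n : lipHom E F) <= e.
Proof.
move=> uC.
have pt (x : E) : exists l : F, (fun n => u n x) @ \oo --> l.
  apply: fcomplete => e e0.
  have x0 : 0 < fdist x 0 + 1 by rewrite ltr_wpDl// fdist_ge0.
  have [N NP] := uC (e / (fdist x 0 + 1)) (divr_gt0 e0 x0).
  exists N => m n Nm Nn; rewrite fdistB.
  apply: le_lt_trans (lipHom_le (u m - u n) x) _.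
  have := NP m n Nm Nn; rewrite ltr_pdivlMr// => /(le_lt_trans _); apply.
  by rewrite ler_wpM2l ?Lip_ge0// lerDl.
pose l x := sval (cid (pt x)).
have lP x : (fun n => u n x) @ \oo --> l x := svalP (cid (pt x)).
have lu e : 0 < e -> exists N, forall n x, (N <= n)%N ->
    fdist (l x - u n x) 0 <= e * fdist x 0.
  move=> e0; have [N NP] := uC e e0; exists N => n x Nn.
  apply/ler_addgt0Pl => d d0; have [N' N'P] := fdist_cvg (lP x) d0.
  pose m := maxn N N'; rewrite -fdistB (le_trans (fdist_triangle (u m x) _ _))//.
  apply: lerD; first by apply/ltW/N'P/leq_maxr.
  rewrite fdistB (le_trans (lipHom_le (u m - u n) x))// ler_wpM2r ?fdist_ge0//.
  by apply/ltW/NP; rewrite ?leq_maxl.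
have llin : linear l.
  move=> a x y; apply: fdist_eq; apply/le_anti; rewrite fdist_ge0 andbT.
  have [k ka] : exists k : nat, `|a| <= k%:R.
    by exists (Num.truncn `|a|).+1; exact/ltW/truncnS_gt.
  pose c := fdist (a *: x + y) 0 + (k%:R * fdist x 0 + fdist y 0) + 1.
  have c0 : 0 < c.
    by rewrite /c ltr_wpDl// !addr_ge0 ?mulr_ge0 ?fdist_ge0.
  apply/ler_addgt0Pl => e e0; rewrite addr0.
  have [N NP] := lu (e / c) (divr_gt0 e0 c0).
  have -> : e = e / c * c by rewrite divfK// gt_eqF.
  pose v := u N; have vl : linear v := (lipHomP v).1.
  rewrite fdistB.
  have -> : l (a *: x + y) - (a *: l x + l y) =
     (l (a *: x + y) - v (a *: x + y)) + (- (a *: (l x - v x)) + - (l y - v y)).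
    rewrite vl -opprD scalerBr [a *: l x - _ + _]addrACA -opprD opprB.
    by rewrite subrKA.
  apply: le_trans (fdistD _ _) _.
  rewrite [in leRHS]/c -[X in _ * X]addrA mulrDr -/c.
  apply: lerD; first exact: NP.
  apply: le_trans (fdistD _ _) _; rewrite !fdistN.
  apply: (@le_trans _ _ (k%:R * (e / c * fdist x 0) + e / c * fdist y 0)).
    apply: lerD; last exact: NP.
    by apply: le_trans (fdistZn _ ka) _; rewrite ler_wpM2l// NP.
  rewrite mulrCA -mulrDr ler_wpM2l ?divr_ge0 ?ltW//.
  by rewrite ltrDl.
have lip_l : l \in @lip_linear_pred R E F.
  apply/asboolP; split=> //; have [N NP] := lu 1 ltr01.
  have [] // := @Lip_le _ _ _ l (1 + Lip (u N)).
  - by rewrite addr_ge0 ?Lip_ge0.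
  - exact: lip_linear0.
  move=> x; rewrite -[l x](subrK (u N x)) (le_trans (fdistD _ _))//.
  by rewrite mulrDl lerD ?NP ?lipHom_le.
exists (LipHom lip_l) => e e0; have [N NP] := lu e e0; exists N => n Nn.
by apply: Lip_lipHom_le => [|x]; [exact: ltW|exact: NP].
Qed.

Lemma lipHom0_complete (u : nat -> lipHom0) :
  (forall e : R, 0 < e -> exists N, forall m n, (N <= m)%N -> (N <= n)%N ->
     lip_dist0 (u m) (u n) < e) ->
  exists K, u @ \oo --> K.
Proof.
move=> /lipHom_complete[L LP].
have CL : L \in lip_component.
  apply/asboolP/component_closed; first exact: closedT.
  move=> U /nbhs_lipHom[e e0 eU].
  have [N NP] : exists N, forall n, (N <= n)%N ->
      Lip (L - \val (u n) : lipHom E F) <= e / 2 by apply: LP; rewrite divr_gt0.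
  exists (\val (u N)); split; first exact/asboolP/(lipHom_ofP (u N)).
  apply: eU; rewrite (le_lt_trans (NP N _))//.
  by rewrite ltr_pdivrMr// mulr_natr mulr2n ltrDl.
exists (LipHom0 CL) => U /nbhs_lipHom0[e e0 eU].
have [N NP] : exists N, forall n, (N <= n)%N ->
      Lip (L - \val (u n) : lipHom E F) <= e / 2 by apply: LP; rewrite divr_gt0.
exists N => // n /= Nn; apply: eU.
apply: (le_lt_trans (NP n Nn)).
by rewrite ltr_pdivrMr// mulr_natr mulr2n ltrDl.
Qed.

Lemma lip_dist0D2r K'' K K' : lip_dist0 (K + K'') (K' + K'') = lip_dist0 K K'.
Proof. by rewrite !lip_dist0E opprD addrACA subrr addr0. Qed.

Lemma lip_ball0_convex r : absolutely_convex [set K | lip_dist0 K 0 < r].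
Proof.
move=> a b K K' ab /=; rewrite !lip_dist0E !subr0 => Kr K'r.
by rewrite (le_lt_trans (Lip_conv _ _ ab))// gt_max Kr.
Qed.

Lemma lipHom0_nbhsE K : nbhs K =
  filter_from [set e : R | 0 < e] (fun e => [set K' | lip_dist0 K K' < e]).
Proof.
by apply/seteqP; split=> U /nbhs_lipHom0.
Qed.

(* The connected component of the zero map, as a Frechet space. *)
Definition lipHom0_frechet : frechet R :=
  @Frechet R lipHom0 lip_dist0 lip_dist0xx lip_dist0_eq
    lip_dist0_sym lip_dist0_triangle lip_dist0D2r lip_ball0_convex
    lipHom0_nbhsE lipHom0_complete.

End LipHom0.

Section MCmaps.
Context {R : realType}.

Section Differentiability.
Context {E F : frechet R}.
Implicit Types (U : set E) (P : E -> F).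

Definition diff_quot P (p h : E) (t : R) : F := t^-1 *: (P (p + t *: h) - P p).

Definition dir_derivable P (p h : E) : Prop :=
  exists l : F, diff_quot P p h t @[t --> (0 : R)^'] --> l.

Definition dir_derive P (p h : E) : F :=
  xget 0 [set l : F | diff_quot P p h t @[t --> (0 : R)^'] --> l].

(* A map on an open set U is encoded by a total map; only its values on U
   matter, and so do those of [dir_derive P] since U is open. *)
Definition Keller_differentiable U P : Prop :=
  [/\ {within U, continuous P},
      forall p h, U p -> dir_derivable P p h,
      forall p, U p -> linear (dir_derive P p) /\ continuous (dir_derive P p),
      {within U, continuous (dir_derive P : E -> {compact-open, E -> F})} &
      {within U `*` setT, continuous (fun uh : E * E => dir_derive P uh.1 uh.2)}].

Definition bounded_differentiable U P : Prop :=
  Keller_differentiable U P /\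
  exists D : E -> lipHom E F,
    (forall p, U p -> forall h, D p h = dir_derive P p h) /\
    {within U, continuous D}.

End Differentiability.

Fixpoint MC (k : nat) (E F : frechet R) (U : set E) (P : E -> F) : Prop :=
  match k with
  | 0%N => {within U, continuous P}
  | 1%N => bounded_differentiable U P
  | (_.+1 as k').+1 => bounded_differentiable U P /\
      forall x0, U x0 -> exists (V : set E) (Q : E -> lipHom0 E F),
        [/\ open_nbhs x0 V, connected V, V `<=` U,
            forall x, V x -> forall h, Q x h = dir_derive P x h - dir_derive P x0 h
          & @MC k' E (lipHom0_frechet E F) V Q]
  end.

(* [Some k] stands for the order k and [None] for the order infinity. *)
Definition MCx (k : option nat) (E F : frechet R) (U : set E) (P : E -> F) :=
  if k is Some k' then MC k' U P else forall k', MC k' U P.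

End MCmaps.

Record chart (X Y : topologicalType) := Chart {
  cdom : set X;
  cmap : X -> Y;
  cinv : Y -> X;
  cdom_open : open cdom;
  cimage_open : open (cmap @` cdom);
  cmapK : {in cdom, cancel cmap cinv};
  cmap_continuous : {within cdom, continuous cmap};
  cinv_continuous : {within cmap @` cdom, continuous cinv}
}.

Definition overlap (X Y Z : topologicalType) (c : chart X Y) (c' : chart X Z) :
  set Y := cmap c @` (cdom c `&` cdom c').

Definition transition (X Y Z : topologicalType) (c : chart X Y)
  (c' : chart X Z) : Y -> Z := cmap c' \o cinv c.

Record frechet_atlas (R : realType) (X : topologicalType) := FrechetAtlas {
  aidx : Type;
  amodel : aidx -> frechet R;
  achart : forall i, chart X (amodel i)
}.
Arguments achart {R X} _ _.

Definition MC_frechet_manifold (R : realType) (k : option nat)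
    (X : topologicalType) (A : frechet_atlas R X) : Prop :=
  [/\ k != Some 0%N, hausdorff_space X,
      \bigcup_i cdom (achart A i) = setT &
      forall i j, MCx k (overlap (achart A i) (achart A j))
                        (transition (achart A i) (achart A j))].

Definition bounded_frechet_manifold (R : realType) (X : topologicalType)
  (A : frechet_atlas R X) : Prop := exists k, MC_frechet_manifold k A.

Section Smooth.
Context {R : realType} {n : nat} {W : normedModType R}.

Fixpoint Ck (k : nat) (O : set 'rV[R]_n) (f : 'rV[R]_n -> W) : Prop :=
  if k is k'.+1 then
    (forall x, O x -> differentiable f x) /\ (forall v, Ck k' O ('D_v f))
  else {within O, continuous f}.

Definition smooth_on (O : set 'rV[R]_n) (f : 'rV[R]_n -> W) : Prop :=
  forall k, Ck k O f.

Definition iter_partial (s : seq 'I_n) (f : 'rV[R]_n -> W) : 'rV[R]_n -> W :=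
  foldr (fun (i : 'I_n) g => 'D_(delta_mx 0 i) g) f s.

End Smooth.

Record smooth_manifold (R : realType) (n : nat) := SmoothManifold {
  mspace :> topologicalType;
  midx : Type;
  mchart : midx -> chart mspace 'rV[R]_n;
  m_hausdorff : hausdorff_space mspace;
  m_second_countable : @second_countable mspace;
  mchart_cover : \bigcup_i cdom (mchart i) = setT;
  mchart_smooth : forall i j,
    smooth_on (overlap (mchart i) (mchart j)) (transition (mchart i) (mchart j))
}.

Section TangentSpace.
Context {R : realType} {n : nat} (M : smooth_manifold R n).
Implicit Types (i j : midx M) (p : M).

(* Vectors are rows: coordinates v in the chart i become [v *m chart_jac i j p]
   in the chart j. *)
Definition chart_jac i j p : 'M[R]_n :=
  'J (transition (mchart i) (mchart j)) (cmap (mchart i) p).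

(* A tangent vector at p is the family of its coordinates in all the charts
   around p; the entries at the other charts are irrelevant, and set to 0. *)
Definition tangent_axiom p (v : midx M -> 'rV[R]_n) : Prop :=
  (forall i, ~ cdom (mchart i) p -> v i = 0) /\
  (forall i j, cdom (mchart i) p -> cdom (mchart j) p ->
     v j = v i *m chart_jac i j p).

Definition tangent_pred p : {pred midx M -> 'rV[R]_n} :=
  fun v => `[< tangent_axiom p v >].

Lemma tangent_submod p : submod_closed (tangent_pred p).
Proof.
split=> [|a u v /asboolP[u0 uJ] /asboolP[v0 vJ]]; apply/asboolP; split.
- by [].
- by move=> i j _ _; rewrite -[LHS]/(0 : 'rV_n) -[X in X *m _]/(0 : 'rV_n) mul0mx.
- move=> i ip; rewrite -[LHS]/(a *: u i + v i) u0// v0//.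
  by rewrite scaler0 addr0.
- move=> i j ip jp; rewrite -[LHS]/(a *: u j + v j).
  rewrite -[X in X *m _]/(a *: u i + v i) (uJ i j)// (vJ i j)//.
  by rewrite mulmxDl -scalemxAl.
Qed.

HB.instance Definition _ p := GRing.isSubmodClosed.Build R
  (midx M -> 'rV[R]_n) (tangent_pred p) (tangent_submod p).

Record tangent p := Tangent {
  tcoord :> midx M -> 'rV[R]_n;
  tcoordP : tcoord \in tangent_pred p }.

HB.instance Definition _ p := [isSub for @tcoord p].
HB.instance Definition _ p := [Choice of tangent p by <:].
HB.instance Definition _ p := [SubChoice_isSubLmodule of tangent p by <:].

Definition coord_fun i p (w : 'rV[R]_n) (j : midx M) : 'rV[R]_n :=
  if `[< cdom (mchart i) p /\ cdom (mchart j) p >]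
  then w *m chart_jac i j p else 0.

Lemma near_overlap i j p : cdom (mchart i) p -> cdom (mchart j) p ->
  \forall x \near cmap (mchart i) p, cdom (mchart j) (cinv (mchart i) x) /\
    (cmap (mchart i) @` cdom (mchart i)) x.
Proof.
move=> ip jp; set c := mchart i; set c' := mchart j.
have ci : (cmap c @` cdom c) (cmap c p) by exists p.
have near1 : \forall x \near cmap c p, (cmap c @` cdom c) x.
  exact: open_nbhs_nbhs (conj (cimage_open c) ci).
have := @cinv_continuous _ _ c; rewrite continuous_open_subspace; last first.
  exact: cimage_open.
move=> /(_ (cmap c p)); rewrite inE => /(_ ci) /(_ (cdom c')).
rewrite cmapK ?inE// => H; near=> x; split; near: x => //.
by apply: H; exact: open_nbhs_nbhs (conj (cdom_open c') jp).
Unshelve. all: by end_near. Qed.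

Lemma transition_diff i j p : cdom (mchart i) p -> cdom (mchart j) p ->
  differentiable (transition (mchart i) (mchart j)) (cmap (mchart i) p).
Proof.
move=> ip jp; apply: ((@mchart_smooth _ _ M i j) 1%N).1.
by exists p.
Qed.

Lemma chart_jacM i j k p :
  cdom (mchart i) p -> cdom (mchart j) p -> cdom (mchart k) p ->
  chart_jac i j p *m chart_jac j k p = chart_jac i k p.
Proof.
move=> ip jp kp; apply/row_matrixP => l; rewrite !rowE; set v := delta_mx 0 l.
have tE : transition (mchart i) (mchart j) (cmap (mchart i) p) = cmap (mchart j) p.
  by rewrite /transition /= cmapK ?inE.
have dj : differentiable (transition (mchart j) (mchart k))
    (transition (mchart i) (mchart j) (cmap (mchart i) p)).
  by rewrite tE; exact: transition_diff.
have di := transition_diff ip jp.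
rewrite mulmxA /chart_jac -[RHS]deriveEjacobian; last exact: transition_diff.
have nE : \forall x \near cmap (mchart i) p,
    transition (mchart i) (mchart k) x =
    (transition (mchart j) (mchart k) \o transition (mchart i) (mchart j)) x.
  near=> x; have [jx _] : cdom (mchart j) (cinv (mchart i) x) /\
    (cmap (mchart i) @` cdom (mchart i)) x by near: x; exact: near_overlap.
  by rewrite /transition /= cmapK ?inE.
rewrite (near_eq_derive _ nE) deriveE; last exact: differentiable_comp.
rewrite diff_comp//= tE.
rewrite -deriveE; last by rewrite -tE.
rewrite deriveEjacobian; last by rewrite -tE.
by rewrite -deriveE// deriveEjacobian.
Unshelve. all: by end_near. Qed.

Lemma chart_jacxx i p : cdom (mchart i) p -> chart_jac i i p = 1%:M.
Proof.
move=> ip; apply/row_matrixP => l; rewrite !rowE; set v := delta_mx 0 l.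
rewrite /chart_jac -deriveEjacobian; last exact: transition_diff.
have nE : \forall x \near cmap (mchart i) p,
    transition (mchart i) (mchart i) x = id x.
  near=> x; have [_ [q iq <-]] : cdom (mchart i) (cinv (mchart i) x) /\
    (cmap (mchart i) @` cdom (mchart i)) x by near: x; exact: near_overlap.
  by rewrite /transition /= cmapK ?inE.
by rewrite (near_eq_derive _ nE) derive_id mulmx1.
Unshelve. all: by end_near. Qed.

Lemma coord_funP i p w : coord_fun i p w \in tangent_pred p.
Proof.
apply/asboolP; split=> [j jp|j k jp kp]; rewrite /coord_fun.
  by case: asboolP => // -[].
have [ip|ip] := pselect (cdom (mchart i) p); last first.
  by rewrite !asboolF ?mul0mx// => -[].
rewrite !asboolT; [|by split|by split].
rewrite -mulmxA; congr (_ *m _); exact/esym/chart_jacM.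
Qed.

(* The tangent vector at p with coordinates w in the chart i (0 if p is outside
   the domain of i). *)
Definition coord_vec i p w : tangent p := Tangent (coord_funP i p w).

Lemma coord_vecE i p w : cdom (mchart i) p -> coord_vec i p w i = w.
Proof.
move=> ip; rewrite /= /coord_fun asboolT; last by split.
by rewrite chart_jacxx// mulmx1.
Qed.

End TangentSpace.
Arguments coord_vec {R n M} i p w.

Section Tensors.
Context {R : realType} {n : nat} (M : smooth_manifold R n).

Definition form_field : Type := forall p : M, tangent p -> tangent p -> R.

Definition form_components (h : form_field) (i : midx M) (x : 'rV[R]_n) :
    'M[R]_n :=
  \matrix_(k, l) let p := cinv (mchart i) x in
    h p (coord_vec i p (delta_mx 0 k)) (coord_vec i p (delta_mx 0 l)).

Record sym2_section := Sym2Section {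
  form : form_field;
  form_sym : forall p (u v : tangent p), form u v = form v u;
  form_linear : forall p (u : tangent p), linear (form u : tangent p -> R^o);
  form_smooth : forall i, smooth_on (cmap (mchart i) @` cdom (mchart i))
    (form_components (@form) i)
}.

HB.instance Definition _ := gen_eqMixin sym2_section.
HB.instance Definition _ := gen_choiceMixin sym2_section.

Definition chart_compacts (i : midx M) (K : set 'rV[R]_n) : Prop :=
  compact K /\ K `<=` cmap (mchart i) @` cdom (mchart i).

Definition jets (h : sym2_section) : prod_topology
    (fun q : midx M * seq 'I_n => {family chart_compacts q.1, 'rV[R]_n -> 'M[R]_n})
  := fun q => iter_partial q.2 (form_components (@form h) q.1).

(* The C^oo topology: uniform convergence of all partial derivatives of the
   components on the compact subsets of every chart. *)
HB.instance Definition _ := Topological.copy sym2_section (initial_topology jets).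

Definition riemannian_metrics : set sym2_section :=
  [set g | forall (p : M) (v : tangent p), v != 0 -> 0 < form g v v].

End Tensors.
Arguments riemannian_metrics {R n} M.

(* Main.v *)
Require Import Defs.
From HB Require Import structures.
From mathcomp Require Import all_boot all_order all_algebra.
From mathcomp Require Import all_classical all_reals all_analysis.
From mathcomp Require Import lra ring.

Import Order.TTheory GRing.Theory Num.Theory.
Import numFieldNormedType.Exports.

Local Open Scope classical_set_scope.
Local Open Scope ring_scope.

Set Implicit Arguments.
Unset Strict Implicit.
Unset Printing Implicit Defensive.

(* The metrics form an open subset of the vector space S of smooth symmetric
   (0,2)-tensors, so once S is a Frechet space the inclusion is a global chart,
   its transition map is the identity, and the identity is MC^oo since its
   derivative is constant.

   The C^oo topology of S involves every chart of an arbitrary atlas. By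
   compactness finitely many charts i, with compact sets K_i whose interiors
   cover M, suffice: the chain rule writes the jets of order m in a chart j as
   combinations, with smooth coefficients, of the jets of order at most m in the
   chart i, so they are locally bounded by the latter. This gives a
   translation-invariant metric; completeness holds because locally uniform
   limits commute with differentiation, and openness because a continuous
   positive definite form is bounded below on K_i times the unit sphere. *)

(** * Lipschitz linear maps as MC^k-maps *)

Section FrechetMaps.
Context {R : realType}.
Implicit Types E F : frechet R.

Lemma nbhs_fdistP E (x : E) (U : set E) :
  nbhs x U <-> exists2 e : R, 0 < e & forall y, fdist x y < e -> U y.
Proof. by rewrite fnbhsE. Qed.

Lemma frechet_hausdorff E : hausdorff_space E.
Proof.
move=> x y xy; apply/fdist_eq/le_anti; rewrite fdist_ge0 andbT.
apply/ler_addgt0Pl => e e0; rewrite addr0.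
have e20 : 0 < e / 2 by rewrite divr_gt0.
have [||z [/= xz yz]] := xy [set z | fdist x z < e / 2] [set z | fdist y z < e / 2].
- by apply/nbhs_fdistP; exists (e / 2).
- by apply/nbhs_fdistP; exists (e / 2).
rewrite (le_trans (fdist_triangle z _ _))// [leRHS]splitr lerD ?ltW//.
by rewrite fdist_sym.
Qed.

Lemma lipHom_is_continuous E F (L : lipHom E F) : continuous L.
Proof.
move=> x U /nbhs_fdistP[e e0 eU]; apply/nbhs_fdistP.
(* The added 1 keeps the divisor positive when [Lip L] is 0. *)
have c0 : 0 < Lip L + 1 by rewrite ltr_wpDl// Lip_ge0.
exists (e / (Lip L + 1)); first by rewrite divr_gt0.
move=> y; rewrite ltr_pdivlMr// => xy; apply: eU.
have -> : fdist (L x) (L y) = fdist (L (x - y)) 0.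
  rewrite fdistB; congr fdist; have := (lipHomP L).1 (-1) y x.
  by rewrite !scaleN1r (addrC (- y)) (addrC (- L y)) => ->.
rewrite (le_lt_trans (lipHom_le _ _))// -fdistB (le_lt_trans _ xy)//.
by rewrite mulrC ler_wpM2l ?fdist_ge0// lerDl.
Qed.

Lemma open_fball E (x : E) (r : R) : open [set y | fdist x y < r].
Proof.
rewrite openE => y /= xy; apply/nbhs_fdistP; exists (r - fdist x y).
  by rewrite subr_gt0.
by move=> z; rewrite ltrBrDl; apply/le_lt_trans/fdist_triangle.
Qed.

Lemma line_continuous E (x v : E) : continuous (fun t : R => x + t *: v).
Proof.
move=> t U /= /(@add_continuous E (x, t *: v))[[A B] /= [nA nB] AB].
have [[C D] /= [nC nD] CD] := @scale_continuous R E (t, v) B nB.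
apply: filterS nC => s Cs; apply: (AB (x, s *: v)); split => /=.
  exact: nbhs_singleton.
by apply: (CD (s, v)); split=> //=; exact: nbhs_singleton.
Qed.

(** A ball is the union of the segments from its center to its points; they stay inside because
    scaling by a factor in [0, 1] does not increase the distance to 0. The recursive clause of [MC]
    asks for connected neighborhoods, and balls supply them. *)
Lemma connected_fball E (x : E) (r : R) : 0 < r -> connected [set y | fdist x y < r].
Proof.
move=> r0; set B := (X in connected X).
pose seg y := (fun t : R => x + t *: (y - x)) @` `[0%R, 1%R]%classic.
have -> : B = \bigcup_(y in B) seg y.
  apply/seteqP; split=> [y By|_ [y By [t + <-]]].
    exists y => //; exists 1; first by rewrite /= in_itv/= ler01 lexx.
    by rewrite scale1r addrC subrK.
  rewrite /= in_itv/= => /andP[t0 t1].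
  rewrite /B/= fdist_sym fdistB addrC addKr (le_lt_trans (fdistZ1 _ _)) ?ger0_norm//.
  by rewrite -fdistB fdist_sym.
apply: bigcup_connected.
  exists x => y By; exists 0; first by rewrite /= in_itv/= lexx ler01.
  by rewrite scale0r addr0.
move=> y By; apply: connected_continuous_connected.
  exact: segment_connected.
apply: continuous_subspaceT.
exact: line_continuous.
Qed.

(** For small [t] the point [p + t *: h] is still in [U], so the difference quotient is eventually
    constant. The value of [dir_derive] then follows from uniqueness of limits in [F]. *)
Lemma lipHom_dir_derive E F (U : set E) (L : lipHom E F) (P : E -> F) p h :
  open U -> U p -> (forall x, U x -> P x = L x) ->
  dir_derivable P p h /\ dir_derive P p h = L h.
Proof.
move=> oU Up PL.
have H : diff_quot P p h t @[t --> (0 : R)^'] --> L h.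
  apply: cvg_near_cst.
  have : \forall t \near (0 : R), U (p + t *: h).
    have : (fun t : R => p + t *: h) @ (0 : R) --> p + 0 *: h.
      exact: line_continuous.
    rewrite scale0r addr0; apply.
    exact: open_nbhs_nbhs.
  move=> U0; near=> t; rewrite /diff_quot !PL//; last first.
    by near: t; apply: nbhs_dnbhs.
  rewrite [p + _]addrC (lipHomP L).1 addrK scalerA mulVf ?scale1r//.
  by near: t; exact: nbhs_dnbhs_neq.
have dP : dir_derivable P p h by exists (L h).
split=> //; rewrite /dir_derive.
apply: xget_unique => // l Hl.
by apply: (cvg_unique (@frechet_hausdorff F) Hl H).
Unshelve. all: by end_near. Qed.

Lemma lipHom_bounded_differentiable E F (U : set E) (L : lipHom E F) (P : E -> F) :
  open U -> (forall x, U x -> P x = L x) -> bounded_differentiable U P.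
Proof.
move=> oU PL.
have dP p h : U p -> dir_derive P p h = L h.
  by move=> Up; exact: (lipHom_dir_derive h oU Up PL).2.
have dPf p : U p -> dir_derive P p = L by move=> Up; apply/funext => h; exact: dP.
split; last first.
  exists (fun=> L); split=> [p Up h|]; first by rewrite dP.
  by apply: continuous_subspaceT => x; exact: cvg_cst.
split.
- apply: (@subspace_eq_continuous _ _ _ (L : E -> F)).
    by move=> x; rewrite inE => Ux; rewrite /from_subspace PL.
  exact/continuous_subspaceT/lipHom_is_continuous.
- by move=> p h Up; exact: (lipHom_dir_derive h oU Up PL).1.
- move=> p /dPf ->; split; first exact: (lipHomP L).1.
  exact: lipHom_is_continuous.
- apply: (@subspace_eq_continuous _ _ _ (fun=> (L : E -> F) : {compact-open, E -> F})).
    by move=> x; rewrite inE => Ux; rewrite /from_subspace dPf.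
  by apply: continuous_subspaceT => x; exact: cvg_cst.
- apply: (@subspace_eq_continuous _ _ _ (fun uh : E * E => L uh.2)).
    by move=> [x h]; rewrite inE => -[/= Ux _]; rewrite /from_subspace/= dP.
  apply: continuous_subspaceT => x; apply: continuous_comp; first exact: cvg_snd.
  exact: lipHom_is_continuous.
Qed.

(** On [U] the derivative is constantly [L], so its increment from [x0] is the zero map. That map is
    again the restriction of a Lipschitz linear map, now into [lipHom0_frechet E F]; hence the
    induction on [k] lets the target space vary. *)
Lemma lipHom_MC k E F (U : set E) (L : lipHom E F) (P : E -> F) :
  open U -> (forall x, U x -> P x = L x) -> MC k U P.
Proof.
elim: k F U L P => [|[|k] IH] F U L P oU PL.
- by have [[]] := lipHom_bounded_differentiable oU PL.
- exact: lipHom_bounded_differentiable oU PL.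
split=> [|x0 Ux0]; first exact: lipHom_bounded_differentiable oU PL.
have /nbhs_fdistP[e e0 eU] : nbhs x0 U by exact: open_nbhs_nbhs.
exists [set y | fdist x0 y < e], (fun=> 0); split.
- by split; [exact: open_fball|rewrite /= fdistxx].
- exact: connected_fball.
- exact: eU.
- move=> x /eU Ux h.
  by rewrite (lipHom_dir_derive h oU Ux PL).2 (lipHom_dir_derive h oU Ux0 PL).2 subrr.
- apply: (IH _ _ (0 : lipHom E (lipHom0_frechet E F))) => //; exact: open_fball.
Qed.

Fact id_lip_linear E : (id : E -> E) \in @lip_linear_pred R E E.
Proof.
apply/asboolP; split=> //.
by have [|] // := @Lip_le R E E id 1 ler01 erefl; move=> x; rewrite mul1r.
Qed.

Definition id_lipHom E : lipHom E E := LipHom (id_lip_linear E).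

End FrechetMaps.

(** * Differentiability as an epsilon estimate *)

Section Differentiability.
Context {R : realType} {V W : normedModType R}.
Implicit Types f g : V -> W.

Lemma continuous_normP f x : {for x, continuous f} <->
  forall e, 0 < e -> \forall y \near x, `|f x - f y| < e.
Proof. exact: (@cvgrPdist_lt _ _ _ (nbhs x)). Qed.

Lemma differentiable_approx f x e : differentiable f x -> 0 < e ->
  \forall h \near (0 : V), `|f (h + x) - f x - 'd f x h| <= e * `|h|.
Proof.
move=> /diff_locallyP[_ fx] e0.
have := fx => /eqaddoP /(_ _ e0); apply: filterS => h /=.
by rewrite -[X in `|X| <= _]/(f (h + x) - (f x + 'd f x h)) opprD addrA.
Qed.

(** The little-o expansion determines the differential, so one estimate gives both differentiability
    and the derivative. This is the entry point for functions obtained as limits. *)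
Lemma approx_differentiable f x (df : {linear V -> W}) : continuous df ->
  (forall e, 0 < e ->
    \forall h \near (0 : V), `|f (h + x) - f x - df h| <= e * `|h|) ->
  differentiable f x /\ 'd f x = df :> (V -> W).
Proof.
move=> cdf H.
have E : f \o shift x = cst (f x) + df +o_ 0 id.
  apply/eqaddoP => e e0; have := H _ e0; apply: filterS => h /=.
  by rewrite -[X in _ -> `|X| <= _]/(f (h + x) - (f x + df h)) opprD addrA.
have dE := diff_unique cdf E; split=> //.
by apply/diff_locallyP; rewrite dE.
Qed.

Lemma near_eq_differentiable f g x : (\near x, f x = g x) ->
  differentiable f x -> differentiable g x.
Proof.
move=> fg df; apply: (@approx_differentiable g x ('d f x) _ _).1.
  exact: diff_continuous.
move=> e e0; near=> h; rewrite -(nbhs_singleton fg) -(_ : f (h + x) = g (h + x)).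
  by near: h; exact: differentiable_approx.
near: h; have : \forall h \near (0 : V), f (h + x) = g (h + x).
  by have := fg; rewrite (near_shift 0)/=; under [X in X -> _]eq_near do rewrite subr0.
by [].
Unshelve. all: by end_near. Qed.

End Differentiability.

(** * Locality and linearity of C^k maps and iterated partial derivatives *)

Section SmoothMaps.
Context {R : realType} {n : nat} {W : normedModType R}.
Variables (O : set 'rV[R]_n) (oO : open O).
Implicit Types f g : 'rV[R]_n -> W.

Let near_eqO f g x : O x -> (forall y, O y -> f y = g y) -> \near x, f x = g x.
Proof. by move=> Ox fg; apply: filterS (open_nbhs_nbhs (conj oO Ox)). Qed.

Lemma eq_derive_open f g v x : O x -> (forall y, O y -> f y = g y) ->
  'D_v f x = 'D_v g x.
Proof. by move=> Ox fg; exact/near_eq_derive/near_eqO. Qed.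

Lemma Ck_ext k f g : (forall x, O x -> f x = g x) -> Ck k O f -> Ck k O g.
Proof.
elim: k f g => [|k IH] f g fg /=.
  by apply: subspace_eq_continuous => x; rewrite inE => Ox; exact: fg.
move=> [df Df]; split=> [x Ox|v].
  by apply: near_eq_differentiable (df x Ox); exact: near_eqO.
by apply: IH (Df v) => x Ox; exact: eq_derive_open.
Qed.

Lemma Ck_lincomb k a f g : Ck k O f -> Ck k O g -> Ck k O (fun x => a *: f x + g x).
Proof.
elim: k f g => [|k IH] f g /=.
  rewrite !continuous_open_subspace// => cf cg x Ox.
  apply: (@cvgD _ _ _ _ _ (fun y => a *: f y) g _ _ _ (cg x Ox)).
  exact: cvgZ (cvg_cst _) (cf x Ox).
move=> [df Df] [dg Dg]; split=> [x Ox|v].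
  apply: (@differentiableD _ _ _ (fun x => a *: f x) g); last exact: dg.
  exact/(@differentiableZ _ _ _ f)/df.
apply: Ck_ext (IH _ _ (Df v) (Dg v)) => x Ox.
rewrite -[RHS]/('D_v ((a *: f) + g) x) deriveD ?deriveZ//.
- exact/diff_derivable/df.
- exact/derivableZ/diff_derivable/df.
- exact/diff_derivable/dg.
Qed.

Lemma Ck0 k : Ck k O (fun=> 0 : W).
Proof.
elim: k => [|k IH] /=; first by move=> x; exact: cvg_cst.
split=> [x _|v]; first exact: differentiable_cst.
by apply: Ck_ext IH => x _; rewrite derive_cst.
Qed.

Lemma Ck_sum k m (a : 'I_m -> R) (f : 'I_m -> 'rV[R]_n -> W) :
  (forall i, Ck k O (f i)) -> Ck k O (fun x => \sum_i a i *: f i x).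
Proof.
elim: m a f => [|m IH] a f fk.
  by apply: Ck_ext (Ck0 k) => x _; rewrite big_ord0.
have := Ck_lincomb (a ord_max) (fk ord_max) (IH (fun i => a (widen_ord (leqnSn _) i))
  (fun i => f (widen_ord (leqnSn _) i)) (fun i => fk _)).
by apply: Ck_ext => x _; rewrite big_ord_recr/= addrC.
Qed.

Lemma smooth_differentiable f x : smooth_on O f -> O x -> differentiable f x.
Proof. by move=> /(_ 1%N)[+ _]; exact. Qed.

Lemma smooth_continuous f x : smooth_on O f -> O x -> {for x, continuous f}.
Proof. by move=> fs Ox; exact/differentiable_continuous/smooth_differentiable. Qed.

Lemma smooth_derivable f x v : smooth_on O f -> O x -> derivable f x v.
Proof. by move=> fs Ox; exact/diff_derivable/smooth_differentiable. Qed.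

Lemma smooth_derive f v : smooth_on O f -> smooth_on O ('D_v f).
Proof. by move=> fs k; exact: (fs k.+1).2. Qed.

Lemma smooth_iter_partial f s : smooth_on O f -> smooth_on O (iter_partial s f).
Proof. by move=> fs; elim: s => //= i s; exact: smooth_derive. Qed.

Lemma eq_iter_partial f g s : (forall x, O x -> f x = g x) ->
  forall x, O x -> iter_partial s f x = iter_partial s g x.
Proof. by move=> fg; elim: s => //= i s IH x Ox; exact: eq_derive_open. Qed.

Lemma smooth_lincomb a f g : smooth_on O f -> smooth_on O g ->
  smooth_on O (fun x => a *: f x + g x).
Proof. by move=> fs gs k; exact: Ck_lincomb. Qed.

Lemma iter_partial_lincomb a f g s : smooth_on O f -> smooth_on O g ->
  forall x, O x -> iter_partial s (fun x => a *: f x + g x) x =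
    a *: iter_partial s f x + iter_partial s g x.
Proof.
move=> fs gs; elim: s => //= i s IH x Ox.
rewrite (eq_derive_open _ Ox IH).
have df := @smooth_derivable _ x (delta_mx 0 i) (smooth_iter_partial s fs) Ox.
have dg := @smooth_derivable _ x (delta_mx 0 i) (smooth_iter_partial s gs) Ox.
rewrite -[LHS]/('D_(delta_mx 0 i) ((a *: iter_partial s f) + iter_partial s g) x).
by rewrite deriveD ?deriveZ//; exact: derivableZ.
Qed.

End SmoothMaps.

Section MatrixNorm.
Context {R : realType} {p q : nat}.
Implicit Types A : 'M[R]_(p, q).

Lemma le_mx_norm A i j : `|A i j| <= `|A|.
Proof.
by rewrite [leRHS]/Num.Def.normr/= mx_normrE; exact: (le_bigmax _ _ (i, j)).
Qed.

Lemma mx_norm_le A c : 0 <= c -> (forall i j, `|A i j| <= c) -> `|A| <= c.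
Proof.
move=> c0 Ac; rewrite [leLHS]/Num.Def.normr/= mx_normrE.
by apply: bigmax_le => // -[i j] _; exact: Ac.
Qed.

End MatrixNorm.

(** * Mean value inequality and differentiation of locally uniform limits *)

Section UniformLimits.
Context {R : realType} {n p q : nat}.
Implicit Types f g : 'rV[R]_n -> 'M[R]_(p, q).

(** Both sides are difference quotients: of the curve [t |-> f (x + t *: h)] in direction 1, and of
    [f] in direction [h]. Derivatives along a line thus become one-variable derivatives. *)
Let line_quot f (x h : 'rV[R]_n) (t : R) :
  (fun s : R => s^-1 *: (f (x + (s *: 1 + t) *: h) - f (x + t *: h))) =
  (fun s => s^-1 *: (f (s *: h + (x + t *: h)) - f (x + t *: h))).
Proof. by apply/funext => s; rewrite /= [s *: 1]mulr1 scalerDl addrCA. Qed.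

Lemma derive_line f (x h : 'rV[R]_n) (t : R) :
  'D_1 (fun t : R => f (x + t *: h)) t = 'D_h f (x + t *: h).
Proof. by rewrite /derive -line_quot. Qed.

Lemma derivable_line f (x h : 'rV[R]_n) (t : R) :
  derivable f (x + t *: h) h ->
  derivable (fun t : R => f (x + t *: h)) t 1.
Proof. by rewrite /derivable -line_quot. Qed.

(** The matrix norm is the maximum over the entries, so the scalar mean value theorem can be applied
    to each entry separately, with an intermediate point that may depend on the entry. *)
Lemma mean_value_le f (x h : 'rV[R]_n) (w : 'M[R]_(p, q)) (c : R) : 0 <= c ->
  (forall t : R, 0 <= t <= 1 -> differentiable f (x + t *: h)) ->
  (forall t : R, 0 <= t <= 1 -> `|'D_h f (x + t *: h) - w| <= c) ->
  `|f (x + h) - f x - w| <= c.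
Proof.
move=> c0 df Df; apply: mx_norm_le => // i j; rewrite !mxE.
pose F (t : R) : R := f (x + t *: h) i j.
have dF (t : R) : 0 <= t <= 1 -> is_derive t 1 F ('D_h f (x + t *: h) i j).
  move=> t01; have dl : derivable (fun t : R => f (x + t *: h)) t 1.
    exact/derivable_line/diff_derivable/df.
  apply: DeriveDef; first by have /derivable_mxP := dl; exact.
  by rewrite -derive_line derive_mx// mxE.
have [t|t|t t01] := @MVT_segment R F (fun t => 'D_h f (x + t *: h) i j) 0 1 ler01.
- by rewrite in_itv/= => /andP[t0 t1]; apply: dF; rewrite !ltW.
- apply: derivable_within_continuous => // s; rewrite in_itv/= => /dF [].
  by [].
rewrite subr0 mulr1 /F scale1r scale0r addr0 => ->.
have := le_mx_norm ('D_h f (x + t *: h) - w) i j; rewrite !mxE => /le_trans; apply.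
by apply: Df; move: t01; rewrite in_itv.
Qed.

Lemma rowE_sum (v : 'rV[R]_n) : v = \sum_i v 0 i *: delta_mx 0 i.
Proof. by rewrite {1}(matrix_sum_delta v) big_ord1. Qed.

Lemma derive_partials f x v : differentiable f x ->
  'D_v f x = \sum_i v 0 i *: 'D_(delta_mx 0 i) f x.
Proof.
move=> df; rewrite deriveE// {1}(rowE_sum v) linear_sum; apply: eq_bigr => i _.
by rewrite linearZ deriveE.
Qed.

Variables (O : set 'rV[R]_n) (oO : open O).

Lemma unif_limit_continuous (f : nat -> 'rV[R]_n -> 'M[R]_(p, q)) g (x : 'rV[R]_n) :
  (forall k, {for x, continuous (f k)}) ->
  (forall e, 0 < e -> \forall y \near x & k \near \oo, `|g y - f k y| < e) ->
  {for x, continuous g}.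
Proof.
move=> fc fg; apply/continuous_normP => e e0.
have e30 : 0 < e / 3 by rewrite divr_gt0.
have [[A B] /= [nA [N _ NB]] AB] := fg _ e30.
have BN : B N by apply: NB => /=.
have /continuous_normP /(_ _ e30) := fc N; apply: filterS2 (nA) => y Ay fy.
have xA := AB (x, N) (conj (nbhs_singleton nA) BN).
have yA := AB (y, N) (conj Ay BN).
have -> : g x - g y = (g x - f N x) + ((f N x - f N y) + - (g y - f N y)).
  by rewrite opprB subrKA subrKA.
rewrite (le_lt_trans (ler_normD _ _))//.
have -> : e = e / 3 + (e / 3 + e / 3) by lra.
rewrite ltrD// (le_lt_trans (ler_normD _ _))// ltrD// normrN.
exact: yA.
Qed.

(** On a ball around [x], and for all large [k], the partials of [f k] are close to [dg i x]. The
    mean value inequality then bounds the error of the linear approximation [L'] to [f k] by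
    [e * |h|], uniformly in [k]; for fixed [h] the bound passes to the limit [g]. *)
Lemma unif_limit_differentiable (f : nat -> 'rV[R]_n -> 'M[R]_(p, q)) g
    (dg : 'I_n -> 'rV[R]_n -> 'M[R]_(p, q)) (x : 'rV[R]_n) : O x ->
  (forall k y, O y -> differentiable (f k) y) ->
  (forall i k, {for x, continuous ('D_(delta_mx 0 i) (f k))}) ->
  (forall y, O y -> f ^~ y @ \oo --> g y) ->
  (forall i e, 0 < e ->
    \forall y \near x & k \near \oo, `|dg i y - 'D_(delta_mx 0 i) (f k) y| < e) ->
  differentiable g x /\ forall v, 'D_v g x = \sum_i v 0 i *: dg i x.
Proof.
move=> Ox df cf fg dfg.
pose L (v : 'rV[R]_n) : 'M[R]_(p, q) := \sum_i v 0 i *: dg i x.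
have Llin : linear L.
  move=> a u v; rewrite /L scaler_sumr -big_split/=; apply: eq_bigr => i _.
  by rewrite !mxE scalerDl scalerA.
pose L' : {linear 'rV[R]_n -> 'M[R]_(p, q)} :=
  HB.pack L (GRing.isLinear.Build _ _ _ _ L Llin).
have cL : continuous L'.
  apply: (@continuous_big 'M[R]_(p, q) _ +%R 0 xpredT _ 'rV[R]_n) => [|i _ v].
    exact: add_continuous.
  apply: (@cvgZ _ _ _ (nbhs v) _ (fun v : 'rV[R]_n => v 0 i) (fun=> dg i x)).
    exact: coord_continuous.
  exact: cvg_cst.
have cdg i : {for x, continuous (dg i)}.
  exact: unif_limit_continuous (cf i) (dfg i).
suff [dgx dE] : differentiable g x /\ 'd g x = L' :> (_ -> _).
  by split=> // v; rewrite deriveE// dE.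
apply: approx_differentiable => // e e0.
(* Each of the [n] partials contributes at most [d * |h|], for a total below [e * |h|]; the
   successor avoids a zero divisor when [n] is 0. *)
pose d := e / n.+1%:R.
have d0 : 0 < d by rewrite divr_gt0.
have d20 : 0 < d / 2 by rewrite divr_gt0.
have FF : Filter (filter_prod (nbhs x) \oo).
  by apply: filter_prod_filter; exact: nbhs_filter.
(* Uniform closeness of the partials of [f k] to [dg i] at nearby points is combined with continuity
   of [dg i] at [x], to compare with the fixed value [dg i x]. *)
have nD : filter_prod (nbhs x) \oo [set z : 'rV[R]_n * nat |
    forall i, `|'D_(delta_mx 0 i) (f z.2) z.1 - dg i x| <= d].
  pose Z i := [set z : 'rV[R]_n * nat |
    `|'D_(delta_mx 0 i) (f z.2) z.1 - dg i x| <= d].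
  have := @filter_forall _ _ Z _ FF.
  apply.
  move=> i; rewrite /Z.
  have [[A B] /= [nA nB] AB] := dfg i _ d20.
  have /continuous_normP /(_ _ d20) nC := cdg i.
  exists (A `&` [set y | `|dg i x - dg i y| < d / 2], B) => /=.
    by split=> //; exact: filterI.
  move=> [y k] /= [[Ay xy] Bk]; have /= yk := AB (y, k) (conj Ay Bk).
  rewrite distrC -(subrKA (dg i y)) (le_trans (ler_normD _ _))//.
  by rewrite [leRHS]splitr lerD// ltW.
have [[A' B] /= [nA' [N _ NB]] A'B] := nD.
pose A := A' `&` O.
have AB z : A z.1 -> B z.2 ->
    O z.1 /\ forall i, `|'D_(delta_mx 0 i) (f z.2) z.1 - dg i x| <= d.
  by case: z => y k /= [A'y Oy] Bk; split=> //; exact: (A'B (y, k)).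
have /nbhs_ballP[r /= r0 rA] : nbhs x A.
  by apply: filterI => //; exact: open_nbhs_nbhs.
have rAt h t : `|h| < r -> 0 <= t <= 1 -> A (x + t *: h).
  move=> hr /andP[t0 t1]; apply: rA; rewrite -ball_normE/= opprD addrA subrr sub0r normrN.
  by rewrite normrZ ger0_norm// (le_lt_trans _ hr)// ler_piMl.
near=> h.
have hr : `|h| < r.
  near: h; apply/nbhs_ballP; exists r => // h; rewrite -ball_normE/=.
  by rewrite sub0r normrN.
have Ae t k : (N <= k)%N -> 0 <= t <= 1 -> _ :=
  fun Nk t01 => AB (x + t *: h, k) (rAt h t hr t01) (NB k Nk).
have est k : (N <= k)%N -> `|f k (x + h) - f k x - L' h| <= e * `|h|.
  move=> Nk; apply: mean_value_le => [|t /(Ae _ _ Nk)[/= Oxt _]|t /(Ae _ _ Nk)[/= Oxt E]].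
  - by rewrite mulr_ge0// ltW.
  - exact: df.
  rewrite derive_partials; last exact: df.
  rewrite /L' /= /L -sumrB; apply: le_trans (ler_norm_sum _ _ _) _.
  apply: (@le_trans _ _ (\sum_(i < n) `|h| * d)).
    apply: ler_sum => i _; rewrite -scalerBr normrZ ler_pM//.
    exact: le_mx_norm.
  rewrite sumr_const card_ord -mulr_natr -mulrA mulrC ler_wpM2r//.
  rewrite /d -mulrA ler_piMr ?(ltW e0)// mulrC ler_pdivrMr// mul1r ler_nat.
  exact: leqnSn.
have Oxh : O (x + h).
  have t1 : 0 <= (1 : R) <= 1 by rewrite ler01 lexx.
  by have /= [+ _] := Ae 1 N (leqnn _) t1; rewrite scale1r.
have cv : (fun k => `|f k (x + h) - f k x - L' h|) @ \oo -->
    `|g (x + h) - g x - L' h|.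
  by apply: cvg_norm; apply: cvgB; [apply: cvgB; exact: fg|exact: cvg_cst].
rewrite [h + x]addrC -(cvg_lim _ cv)//; apply: limr_le.
  by apply/cvg_ex; eexists; exact: cv.
by exists N.
Unshelve. all: by end_near. Qed.
End UniformLimits.

Section SmoothEntries.
Context {R : realType} {n p q : nat}.
Variables (O : set 'rV[R]_n) (oO : open O).
Implicit Types f : 'rV[R]_n -> 'M[R]_(p, q).

Lemma Ck_entry k f a b : Ck k O f -> Ck k O (fun x => f x a b : R).
Proof.
elim: k f => [|k IH] f /=.
  rewrite !continuous_open_subspace// => cf x Ox.
  apply: (@continuous_comp _ _ _ f (fun A => A a b)); first exact: cf.
  exact: coord_continuous.
move=> [df Df]; split=> [x Ox|v].
  apply: (@differentiable_comp _ _ _ _ f (fun A => A a b)); first exact: df.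
  exact: differentiable_coord.
apply: Ck_ext (IH _ (Df v)) => // x Ox.
by rewrite derive_mx ?mxE//; exact/diff_derivable/df.
Qed.

Lemma smooth_entry f a b : smooth_on O f -> smooth_on O (fun x => f x a b : R).
Proof. by move=> fs k; exact: Ck_entry. Qed.

End SmoothEntries.

(** * Differential operators on tensor components across two charts *)

Section SectionJets.
Context {R : realType} {n : nat} (M : smooth_manifold R n).
Implicit Types (i j : midx M) (h g u : sym2_section M) (s t : seq 'I_n).

Definition chart_image i : set 'rV[R]_n := cmap (mchart i) @` cdom (mchart i).

Definition section_jet i s h : 'rV[R]_n -> 'M[R]_n :=
  iter_partial s (form_components (@Defs.form _ _ _ h) i).

Lemma open_chart_image i : open (chart_image i).
Proof. exact: cimage_open. Qed.

Lemma smooth_section_jet i s h : smooth_on (chart_image i) (section_jet i s h).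
Proof. exact/smooth_iter_partial/form_smooth. Qed.

Section ChangeOfChart.
Variables j i : midx M.

Let O := overlap (mchart j) (mchart i).
Let phi := transition (mchart j) (mchart i).

Lemma open_overlap : open O.
Proof.
rewrite openE => _ [p [jp ip] <-].
have := near_overlap jp ip; apply: filterS => x [ix [q jq qx]]; move: ix; rewrite -qx.
by rewrite cmapK ?inE// => iq; exists q.
Qed.

Lemma overlapP x : O x -> [/\ chart_image j x, chart_image i (phi x) &
  cinv (mchart i) (phi x) = cinv (mchart j) x].
Proof.
move=> [p [jp ip] <-]; rewrite /phi /transition/= !cmapK ?inE//.
by split=> //; exists p.
Qed.

Lemma smooth_transition_partial l c :
  smooth_on O (fun x => 'D_(delta_mx 0 l) phi x 0 c : R).
Proof.
apply: smooth_entry; first exact: open_overlap.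
exact/smooth_derive/mchart_smooth.
Qed.

(* Differential operators of order at most m, from components in the chart i to
   functions on the chart j. Multiplication by a smooth function is a
   constructor, so that stability under partial derivatives is an induction and
   no product of smooth functions is ever formed. *)
Inductive jet_operator : nat -> (sym2_section M -> 'rV[R]_n -> R) -> Prop :=
| jet_atom m t a b of (size t <= m)%N :
    jet_operator m (fun u x => section_jet i t u (phi x) a b)
| jet_zero m : jet_operator m (fun _ _ => 0)
| jet_add m T T' of jet_operator m T & jet_operator m T' :
    jet_operator m (fun u x => T u x + T' u x)
| jet_mul m (c : 'rV[R]_n -> R) T of smooth_on O c & jet_operator m T :
    jet_operator m (fun u x => c x * T u x)
| jet_ext m T T' of (forall u x, O x -> T u x = T' u x) & jet_operator m T :
    jet_operator m T'.

Lemma jet_sum m k (T : 'I_k -> sym2_section M -> 'rV[R]_n -> R) :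
  (forall c, jet_operator m (T c)) ->
  jet_operator m (fun u x => \sum_c T c u x).
Proof.
elim: k T => [|k IH] T mT.
  by apply: jet_ext (jet_zero m) => u x _; rewrite big_ord0.
apply: jet_ext (jet_add (IH (fun c => T (widen_ord (leqnSn _) c)) _) (mT ord_max)) => //.
by move=> u x _; rewrite big_ord_recr.
Qed.

Lemma jet_operatorS m T : jet_operator m T -> jet_operator m.+1 T.
Proof.
elim=> {m T} [m t a b tm|m|m T T' _ IH _ IH'|m c T cs _ IH|m T T' TT' _ IH].
- by apply: jet_atom; exact: leqW.
- exact: jet_zero.
- exact: jet_add.
- exact: jet_mul.
- exact: jet_ext IH.
Qed.

Let differentiable_pullback t u x : O x ->
  differentiable (section_jet i t u \o phi) x.
Proof.
move=> Ox; apply: differentiable_comp.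
  exact: (smooth_differentiable (@mchart_smooth _ _ M j i)).
by apply: smooth_differentiable (smooth_section_jet _ _ _) _; case: (overlapP Ox).
Qed.

Lemma jet_operator_differentiable m T : jet_operator m T ->
  forall u x, O x -> differentiable (T u) x.
Proof.
elim=> {m T} [m t a b tm|m|m T T' _ IH _ IH'|m c T cs _ IH|m T T' TT' _ IH] u x Ox.
- apply: (@differentiable_comp _ _ _ _ (section_jet i t u \o phi) (fun A => A a b)).
    exact: differentiable_pullback.
  exact: differentiable_coord.
- exact: differentiable_cst.
- by apply: (@differentiableD _ _ _ (T u) (T' u)); [exact: IH|exact: IH'].
- apply: (@differentiableM _ _ c (T u)); last exact: IH.
  exact: smooth_differentiable Ox.
- apply: near_eq_differentiable (IH u x Ox).
  by apply: filterS (open_nbhs_nbhs (conj open_overlap Ox)) => y; exact: TT'.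
Qed.

(** For an atom the chain rule gives partials of [phi] times jets with one more derivative. For a
    product the Leibniz rule also leaves [T] undifferentiated, and [jet_operatorS] raises that term
    to order [m.+1]. *)
Lemma jet_operator_derive m T l : jet_operator m T ->
  jet_operator m.+1 (fun u x => 'D_(delta_mx 0 l) (T u) x).
Proof.
elim=> {m T} [m t a b tm|m|m T T' TJ IH TJ' IH'|m c T cs TJ IH|m T T' TT' TJ IH].
- have J : jet_operator m.+1 (fun u x => \sum_(c < n)
      'D_(delta_mx 0 l) phi x 0 c * section_jet i (c :: t) u (phi x) a b).
    apply: jet_sum => c; apply: jet_mul; first exact: smooth_transition_partial.
    exact: jet_atom.
  apply: jet_ext J => u x Ox.
  have dphi : differentiable phi x.
    exact: (smooth_differentiable (@mchart_smooth _ _ M j i)).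
  have [_ iphi _] := overlapP Ox.
  have dF : differentiable (section_jet i t u) (phi x).
    exact: smooth_differentiable (smooth_section_jet _ _ _) _.
  transitivity ('D_(delta_mx 0 l) (section_jet i t u \o phi) x a b); last first.
    by rewrite derive_mx ?mxE//; exact/diff_derivable/differentiable_pullback.
  rewrite [in RHS]deriveE; last exact: differentiable_pullback.
  rewrite diff_comp//= -!deriveE// (derive_partials _ dF).
  by rewrite summxE; apply: eq_bigr => c _; rewrite mxE.
- by apply: jet_ext (jet_zero _) => u x _; rewrite derive_cst.
- apply: jet_ext (jet_add IH IH') => u x Ox.
  rewrite -[RHS]/('D_(delta_mx 0 l) (T u + T' u) x) deriveD//; apply: diff_derivable.
  + exact: (jet_operator_differentiable TJ).
  + exact: (jet_operator_differentiable TJ').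
- apply: jet_ext (jet_add (jet_mul cs IH)
    (jet_mul (smooth_derive (delta_mx 0 l) cs) (jet_operatorS TJ))) => u x Ox.
  rewrite -[RHS]/('D_(delta_mx 0 l) (c * T u) x) deriveM//=.
  + by rewrite [T u x *: _]mulrC.
  + exact/diff_derivable/(smooth_differentiable cs).
  + exact/diff_derivable/(jet_operator_differentiable TJ).
- apply: jet_ext IH => u x Ox; apply: eq_derive_open Ox _; first exact: open_overlap.
  by move=> y; exact: TT'.
Qed.

(** The coefficients are continuous, hence bounded near [x0]. The constant and the neighborhood
    depend on the operator only, so they are fixed before the section [u]. *)
Lemma jet_operator_bound m T (x0 : 'rV[R]_n) : jet_operator m T -> O x0 ->
  exists C : R, \forall x \near x0, forall u e,
    (forall t, (size t <= m)%N -> `|section_jet i t u (phi x)| <= e) ->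
    `|T u x| <= C * e.
Proof.
move=> TJ Ox0; elim: TJ => {m T}.
- move=> m t a b tm; exists 1; apply: (@filterE _ (nbhs x0)) => x u e ue.
  by rewrite mul1r (le_trans (le_mx_norm _ _ _))// ue.
- by move=> m; exists 0; apply: (@filterE _ (nbhs x0)) => x u e _; rewrite normr0 mul0r.
- move=> m T T' _ [C HC] _ [C' HC']; exists (C + C').
  apply: filterS2 HC HC' => x HC HC' u e ue.
  by rewrite mulrDl (le_trans (ler_normD _ _))// lerD ?HC ?HC'.
- move=> m c T cs _ [C HC]; exists ((`|c x0| + 1) * C).
  have /continuous_normP /(_ _ ltr01) := smooth_continuous cs Ox0.
  apply: filterS2 HC => x HC cx u e ue.
  rewrite normrM -mulrA ler_pM// ?HC//.
  rewrite -[c x](subKr (c x0)) (le_trans (ler_normB _ _))//.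
  by rewrite lerD2l ltW.
- move=> m T T' TT' _ [C HC]; exists C.
  apply: filterS2 HC (open_nbhs_nbhs (conj open_overlap Ox0)) => x HC Ox u e ue.
  by rewrite -TT'// HC.
Qed.

End ChangeOfChart.
End SectionJets.

(** * Change of coordinates for tensors and the resulting jet estimates *)

Section Components.
Context {R : realType} {n : nat} (M : smooth_manifold R n).
Implicit Types (i j : midx M) (h g u : sym2_section M) (s t : seq 'I_n).

Lemma coord_vec_linear i (p : M) : linear (coord_vec i p).
Proof.
move=> a w w'; apply: val_inj; apply: funext => j.
rewrite -[RHS]/(a *: coord_fun i p w j + coord_fun i p w' j) /= /coord_fun.
case: ifP => _; first by rewrite mulmxDl -scalemxAl.
by rewrite scaler0 addr0.
Qed.

Lemma coord_vec_change j i (p : M) w : cdom (mchart j) p -> cdom (mchart i) p ->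
  coord_vec j p w = coord_vec i p (w *m chart_jac j i p).
Proof.
move=> jp ip; apply: val_inj; apply: funext => k; rewrite /= /coord_fun.
have [kp|kp] := pselect (cdom (mchart k) p); last by rewrite !asboolF// => -[].
rewrite !asboolT; [|by split|by split].
by rewrite -mulmxA; congr (_ *m _); exact/esym/chart_jacM.
Qed.

Lemma tangent_coord i (p : M) (v : tangent p) : cdom (mchart i) p ->
  v = coord_vec i p (v i).
Proof.
move=> ip; have /asboolP[v0 vJ] := tcoordP v.
apply: val_inj; apply: funext => k; rewrite /= /coord_fun.
have [kp|kp] := pselect (cdom (mchart k) p).
  by rewrite asboolT; [exact: vJ|split].
by rewrite asboolF ?v0// => -[].
Qed.

Let form_sumr h (p : M) (v : tangent p) i (w : 'rV[R]_n) :
  Defs.form h v (coord_vec i p w) =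
  \sum_b w 0 b * Defs.form h v (coord_vec i p (delta_mx 0 b)).
Proof.
pose f (w : 'rV[R]_n) : R^o := Defs.form h v (coord_vec i p w).
have fl : linear f by move=> a x y; rewrite /f coord_vec_linear form_linear.
pose f' : {linear 'rV[R]_n -> R^o} := HB.pack f (GRing.isLinear.Build _ _ _ _ f fl).
rewrite -[LHS]/(f' w) {1}(rowE_sum w) linear_sum; apply: eq_bigr => b _.
by rewrite linearZ.
Qed.

Lemma form_coords h i x (w w' : 'rV[R]_n) :
  let p := cinv (mchart i) x in
  Defs.form h (coord_vec i p w) (coord_vec i p w') =
  \sum_a \sum_b w 0 a * (w' 0 b * section_jet i [::] h x a b).
Proof.
move=> p; rewrite form_sym form_sumr; apply: eq_bigr => a _.
rewrite form_sym form_sumr mulr_sumr; apply: eq_bigr => b _.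
by rewrite mxE.
Qed.

Section ChangeOfChart.
Variables j i : midx M.

Let O := overlap (mchart j) (mchart i).
Let phi := transition (mchart j) (mchart i).

(** This is the transformation law of covariant 2-tensors: with row vectors, the [k]-th row of the
    Jacobian of [phi] is its partial derivative in direction [k]. *)
Lemma components_change h x k l : O x ->
  section_jet j [::] h x k l = \sum_a \sum_b 'D_(delta_mx 0 k) phi x 0 a *
    ('D_(delta_mx 0 l) phi x 0 b * section_jet i [::] h (phi x) a b).
Proof.
move=> Ox; rewrite -form_coords; have [_ _ ->] := overlapP Ox.
rewrite mxE; have [p [jp ip] px] := Ox; rewrite -px cmapK ?inE//.
rewrite /= !(coord_vec_change _ jp ip) /chart_jac -/phi.
have dphi : differentiable phi (cmap (mchart j) p) by exact: transition_diff.
by rewrite -!deriveEjacobian.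
Qed.

(** The transformation law settles order 0, and each further derivative is an application of
    [jet_operator_derive]. *)
Lemma jet_operator_section_jet s k l :
  jet_operator j i (size s) (fun u x => section_jet j s u x k l).
Proof.
elim: s k l => [|c s IH] k l /=.
  apply: (@jet_ext _ _ _ _ _ _ (fun u x => \sum_a \sum_b 'D_(delta_mx 0 k) phi x 0 a *
    ('D_(delta_mx 0 l) phi x 0 b * section_jet i [::] u (phi x) a b))).
    by move=> u x Ox; rewrite components_change.
  apply: jet_sum => a; apply: jet_sum => b.
  by do 2 (apply: jet_mul; first exact: smooth_transition_partial); exact: jet_atom.
apply: jet_ext (jet_operator_derive c (IH k l)) => u x Ox.
rewrite /section_jet/= derive_mx ?mxE//.
apply: smooth_derivable (smooth_section_jet j s u) _.
by case: (overlapP Ox).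
Qed.

Lemma section_jet_bound s (x0 : 'rV[R]_n) : O x0 ->
  exists C : R, \forall x \near x0, forall u e,
    (forall t, (size t <= size s)%N -> `|section_jet i t u (phi x)| <= e) ->
    `|section_jet j s u x| <= C * e.
Proof.
move=> Ox0.
pose B (c : R) (kl : 'I_n * 'I_n) := [set x | forall u e,
    (forall t, (size t <= size s)%N -> `|section_jet i t u (phi x)| <= e) ->
    `|section_jet j s u x kl.1 kl.2| <= c * e].
have /choice[C HC] : forall kl, exists c, nbhs x0 (B c kl).
  move=> kl.
  exact: (jet_operator_bound (jet_operator_section_jet s kl.1 kl.2) Ox0).
(* The sum of the absolute values dominates the constant of every single entry. *)
exists (\sum_kl `|C kl|).
have := @filter_forall _ _ (fun kl => B (C kl) kl) _ (nbhs_filter x0) HC.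
apply: filterS => x Bx u e ue.
(* The bound on the jet of order 0 forces [e] to be nonnegative. *)
have e0 : 0 <= e := le_trans (normr_ge0 _) (ue [::] isT).
apply: mx_norm_le => [|k l]; first by rewrite mulr_ge0// sumr_ge0.
apply: le_trans (Bx (k, l) u e ue) _; rewrite ler_wpM2r//.
by rewrite (bigD1 (k, l))//= (le_trans (ler_norm _))// lerDl sumr_ge0.
Qed.

End ChangeOfChart.
End Components.

(** * The vector space of symmetric 2-tensors *)

Section SectionModule.
Context {R : realType} {n : nat} (M : smooth_manifold R n).
Local Notation S := (sym2_section M).
Implicit Types (i j : midx M) (h g u : S) (s t : seq 'I_n).

Lemma sym2_section_eq h g :
  (forall p (v w : tangent p), Defs.form h v w = Defs.form g v w) -> h = g.
Proof.
case: h g => [h hs hl hd] [g gs gl gd] /= hg.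
have {}hg : h = g.
  by do 3 (apply: functional_extensionality_dep => ?); exact: hg.
rewrite hg in hs hl hd *; congr Sym2Section; exact: Prop_irrelevance.
Qed.

Section LinearCombination.
Variables (a : R) (h g : S).

Let f : form_field M := fun p v w => a * Defs.form h v w + Defs.form g v w.

Let fsym p (v w : tangent p) : f v w = f w v.
Proof. by rewrite /f !(form_sym _ v). Qed.

Let flin p (v : tangent p) : linear (f v : tangent p -> R^o).
Proof.
move=> b x y; rewrite /f !form_linear.
by rewrite -![_ *: _]/(_ * _) !mulrDr !mulrA (mulrC a b) addrACA.
Qed.

Let fsmooth i : smooth_on (cmap (mchart i) @` cdom (mchart i)) (form_components f i).
Proof.
have := smooth_lincomb (@cimage_open _ _ (mchart i)) a (form_smooth h i) (form_smooth g i).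
move=> H k; apply: Ck_ext (H k); first exact: cimage_open.
by move=> x _; apply/matrixP => k' l; rewrite !mxE.
Qed.

(** Addition, opposite and scaling are all instances of this one operation, so symmetry, linearity
    and smoothness are checked once. *)
Definition sym2_lin := Sym2Section fsym flin fsmooth.

End LinearCombination.

Let f0 : form_field M := fun p v w => 0.

Let f0_linear p (v : tangent p) : linear (f0 v : tangent p -> R^o).
Proof. by move=> b x y; rewrite /f0 scaler0 addr0. Qed.

Let f0_smooth i : smooth_on (cmap (mchart i) @` cdom (mchart i)) (form_components f0 i).
Proof.
move=> k; apply: Ck_ext (Ck0 _ k); [exact: cimage_open| |exact: cimage_open].
by move=> x _; apply/matrixP => k' l; rewrite !mxE.
Qed.

Let f0_sym p (v w : tangent p) : f0 v w = f0 w v. Proof. by []. Qed.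

Definition sym2_zero : S := Sym2Section f0_sym f0_linear f0_smooth.

Let add h g := sym2_lin 1 h g.
Let opp h := sym2_lin (-1) h sym2_zero.
Let scale a h := sym2_lin a h sym2_zero.

Fact sym2_addA : associative add.
Proof. by move=> h g u; apply: sym2_section_eq => p v w /=; ring. Qed.
Fact sym2_addC : commutative add.
Proof. by move=> h g; apply: sym2_section_eq => p v w /=; ring. Qed.
Fact sym2_add0 : left_id sym2_zero add.
Proof. by move=> h; apply: sym2_section_eq => p v w /=; rewrite /f0; ring. Qed.
Fact sym2_addN : left_inverse sym2_zero opp add.
Proof. by move=> h; apply: sym2_section_eq => p v w /=; rewrite /f0; ring. Qed.

HB.instance Definition _ := GRing.isZmodule.Build S sym2_addA sym2_addC sym2_add0 sym2_addN.

Fact sym2_scaleA a b h : scale a (scale b h) = scale (a * b) h.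
Proof. by apply: sym2_section_eq => p v w /=; rewrite /f0; ring. Qed.
Fact sym2_scale1 : left_id 1 scale.
Proof. by move=> h; apply: sym2_section_eq => p v w /=; rewrite /f0; ring. Qed.
Fact sym2_scaleDr : right_distributive scale +%R.
Proof. by move=> a h g; apply: sym2_section_eq => p v w /=; rewrite /f0; ring. Qed.
Fact sym2_scaleDl h : {morph scale^~ h : a b / a + b}.
Proof. by move=> a b; apply: sym2_section_eq => p v w /=; rewrite /f0; ring. Qed.

HB.instance Definition _ := GRing.Zmodule_isLmodule.Build R S
  sym2_scaleA sym2_scale1 sym2_scaleDr sym2_scaleDl.

Lemma sym2_form_lincomb a h g p (v w : tangent p) :
  Defs.form (a *: h + g) v w = a * Defs.form h v w + Defs.form g v w.
Proof. by rewrite /=; rewrite /f0; ring. Qed.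

Lemma section_jet_lincomb i s a h g x : chart_image i x ->
  section_jet i s (a *: h + g) x = a *: section_jet i s h x + section_jet i s g x.
Proof.
move=> ix; rewrite -(iter_partial_lincomb (@cimage_open _ _ (mchart i)))//; last 2 first.
- exact: form_smooth.
- exact: form_smooth.
apply: (eq_iter_partial (@cimage_open _ _ (mchart i))) ix => y _.
by apply/matrixP => k l; rewrite !mxE; exact: sym2_form_lincomb.
Qed.

Lemma section_jet0 i s x : chart_image i x -> section_jet i s (0 : S) x = 0.
Proof.
move=> ix; have := section_jet_lincomb s (-1) 0 0 ix.
by rewrite scaler0 addr0 scaleN1r addNr.
Qed.

Lemma section_jetZ i s a h x : chart_image i x ->
  section_jet i s (a *: h) x = a *: section_jet i s h x.
Proof. by move=> ix; rewrite -[a *: h]addr0 section_jet_lincomb// section_jet0// addr0. Qed.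

Lemma section_jetD i s h g x : chart_image i x ->
  section_jet i s (h + g) x = section_jet i s h x + section_jet i s g x.
Proof. by move=> ix; rewrite -[h]scale1r section_jet_lincomb// !scale1r. Qed.

Lemma section_jetB i s h g x : chart_image i x ->
  section_jet i s (h - g) x = section_jet i s h x - section_jet i s g x.
Proof. by move=> ix; rewrite section_jetD// -scaleN1r section_jetZ// scaleN1r. Qed.

End SectionModule.

Lemma initial_cvgP (S : choiceType) (T : topologicalType) (f : S -> T)
    (F : set_system S) (x : S) : Filter F ->
  F --> (x : initial_topology f) <-> f @ F --> f x.
Proof.
move=> FF; split=> [Fx|fFx].
  by apply: cvg_comp Fx _; exact: initial_continuous.
move=> A [_ [[B oB <-] Bfx] BA]; apply: filterS BA _.
by apply: fFx; exact: open_nbhs_nbhs.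
Qed.

(** * The C^oo topology as a vector space topology, and finite chart covers *)

Section SectionTopology.
Context {R : realType} {n : nat} (M : smooth_manifold R n).
Local Notation S := (sym2_section M).
Implicit Types (i j : midx M) (h g u : S) (s t : seq 'I_n).

(** The initial topology, the product over charts and words, and uniform convergence on a family of
    compacts unwind in turn to epsilon estimates; all later topological arguments go through
    them. *)
Lemma cvg_sectionP (F : set_system S) h : Filter F ->
  F --> h <-> forall i s K, chart_compacts i K -> forall e : R, 0 < e ->
    \forall g \near F, forall x, K x -> `|section_jet i s h x - section_jet i s g x| < e.
Proof.
move=> FF; apply: (iff_trans (initial_cvgP _ _ _)).
split.
  move=> /cvg_sup H i s K cK e e0.
  have /initial_cvgP := H (i, s).
  move=> /fam_cvgP /(_ K cK) /=.
  move=> /(_ [set f | forall x, K x -> `|section_jet i s h x - f x| < e]); apply.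
  apply/uniform_nbhs; exists [set z : 'M[R]_n * 'M[R]_n | `|z.1 - z.2| < e].
  split=> //.
  rewrite -entourage_ballE; exists e => // -[A B] /=.
  by rewrite -ball_normE.
move=> H; apply/cvg_sup => -[i s]; apply/initial_cvgP/fam_cvgP => K cK.
move=> A /uniform_nbhs[E []]; rewrite -entourage_ballE => -[e /= e0 eE] EA.
apply: filterS (H i s K cK e e0) => g gh; apply: EA => x Kx; apply: eE => /=.
by rewrite -ball_normE; exact: gh.
Qed.

(** A smooth jet is locally bounded, and compactness of [K] makes one large constant work
    everywhere. Continuity of scaling needs this bound. *)
Lemma section_jet_bounded i s h K : chart_compacts i K ->
  exists2 C : R, 0 < C & forall x, K x -> `|section_jet i s h x| <= C.
Proof.
move=> [cK Ki].
have : \forall C \near +oo, K `<=` (fun x => `|section_jet i s h x| <= C).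
  apply: (compact_near_coveringP K).1 => // x Kx.
  have /continuous_normP /(_ _ ltr01) nx :=
    smooth_continuous (smooth_section_jet i s h) (Ki x Kx).
  exists ([set y | `|section_jet i s h x - section_jet i s h y| < 1],
          [set C | `|section_jet i s h x| + 1 <= C]) => /=.
    by split=> //; exact: nbhs_pinfty_ge.
  move=> [y C] /= [xy]; apply: le_trans.
  rewrite -[section_jet i s h y](subKr (section_jet i s h x)).
  by rewrite (le_trans (ler_normB _ _))// lerD2l ltW.
move=> HC; near (pinfty_nbhs R) => C.
exists C; last by near: C.
by near: C; exact: nbhs_pinfty_gt.
Unshelve. all: by end_near. Qed.

Lemma nbhs_section h i s K e : chart_compacts i K -> 0 < e ->
  \forall g \near h, forall x, K x -> `|section_jet i s h x - section_jet i s g x| < e.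
Proof. by move=> cK e0; have /cvg_sectionP := @cvg_id _ (nbhs h); apply. Qed.

Let section_add_continuous : continuous (fun z : S * S => z.1 + z.2).
Proof.
move=> [h g]; apply/cvg_sectionP => i s K cK e e0 /=.
have e20 : 0 < e / 2 by rewrite divr_gt0.
exists ([set h' | forall x, K x -> `|section_jet i s h x - section_jet i s h' x| < e / 2],
  [set h' | forall x, K x -> `|section_jet i s g x - section_jet i s h' x| < e / 2]) => /=.
  by split; exact: nbhs_section.
move=> [h' g'] /= [hh' gg'] x Kx; rewrite !section_jetD; [|exact: cK.2..].
rewrite opprD addrACA [ltRHS]splitr (le_lt_trans (ler_normD _ _))// ltrD//.
  exact: hh'.
exact: gg'.
Qed.

Let section_scale_continuous : continuous (fun z : R^o * S => z.1 *: z.2).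
Proof.
move=> [a h]; apply/cvg_sectionP => i s K cK e e0 /=.
have e20 : 0 < e / 2 by rewrite divr_gt0.
have [C C0 hC] := section_jet_bounded s h cK.
have a10 : 0 < `|a| + 1 by rewrite ltr_wpDl.
(* The bound 1 keeps [|b|] below [|a| + 1], the factor in front of [X - Y]; the bound [e / 2 / C]
   controls [(a - b) *: X]. *)
exists ([set b : R^o | `|a - b| < Num.min 1 (e / 2 / C)],
  [set g | forall x, K x ->
     `|section_jet i s h x - section_jet i s g x| < e / 2 / (`|a| + 1)]) => /=.
  split; last by apply: nbhs_section => //; rewrite divr_gt0.
  apply/nbhs_ballP; exists (Num.min 1 (e / 2 / C)); last by rewrite -ball_normE.
  by rewrite /= lt_min ltr01 !divr_gt0.
move=> [b g] /=; rewrite lt_min => -[/andP[ab1 abC] hg] x Kx.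
rewrite !section_jetZ; [|exact: cK.2..].
set X := section_jet i s h x; set Y := section_jet i s g x.
have -> : a *: X - b *: Y = (a - b) *: X + b *: (X - Y).
  by rewrite scalerBr scalerBl addrA subrK.
rewrite [ltRHS]splitr (le_lt_trans (ler_normD _ _))// !normrZ.
apply: ltrD.
  apply: (@le_lt_trans _ _ (`|a - b| * C)); first by rewrite ler_wpM2l// hC.
  by rewrite -ltr_pdivlMr.
apply: (@le_lt_trans _ _ ((`|a| + 1) * `|X - Y|)).
  rewrite ler_wpM2r// -[b](subKr a) (le_trans (ler_normB _ _))//.
  by rewrite lerD2l ltW.
by rewrite mulrC -ltr_pdivlMr//; exact: hg.
Qed.

HB.instance Definition _ :=
  PreTopologicalNmodule_isTopologicalNmodule.Build S section_add_continuous.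
HB.instance Definition _ :=
  TopologicalNmodule_isTopologicalLmodule.Build R S section_scale_continuous.

Lemma chart_compact_nbhs i (x : 'rV[R]_n) : chart_image i x ->
  exists2 K, chart_compacts i K & exists2 r : R, 0 < r & ball x r `<=` K.
Proof.
move=> ix.
have /nbhs_ballP[r /= r0 rO] : nbhs x (chart_image i).
  by apply: open_nbhs_nbhs; split=> //; exact: cimage_open.
have r20 : 0 < r / 2 by rewrite divr_gt0.
exists (closed_ball x (r / 2)).
  split.
    apply: bounded_closed_compact; last exact: closed_ball_closed.
    exists (`|x| + r); split=> [|A Ar y]; first exact: num_real.
    rewrite closed_ballE// => xy; rewrite /= (le_trans _ (ltW Ar))//.
    rewrite -[y](subKr x) (le_trans (ler_normB _ _))//.
    by rewrite lerD2l (le_trans xy)// ler_pdivrMr// ler_peMr ?ler1n// ltW.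
  move=> y; rewrite closed_ballE// => xy; apply: rO; rewrite -ball_normE/=.
  by rewrite (le_lt_trans xy)// ltr_pdivrMr// ltr_pMr// ltr1n.
by exists (r / 2) => //; exact: subset_closed_ball.
Qed.

Lemma chart_at (p : M) : exists i, cdom (mchart i) p.
Proof.
have [i _ ip] : (\bigcup_i cdom (mchart i)) p by rewrite (mchart_cover M).
by exists i.
Qed.

(** The compact set must be a neighborhood of the image of [p], so that points near [p] are measured
    in the same set. Membership is [List.In] because [midx M] is a bare type. *)
Definition chart_cover (L : seq (midx M * set 'rV[R]_n)) : Prop :=
  (forall c, List.In c L -> chart_compacts c.1 c.2) /\
  forall p : M, exists2 c, List.In c L &
    cdom (mchart c.1) p /\ nbhs (cmap (mchart c.1) p) c.2.

(** Compactness is applied along the filter of lists ordered by inclusion: near each point the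
    covering property holds once the list contains one suitable pair. The filter set so obtained
    contains a basic set, whose own list is the cover. *)
Lemma finite_chart_cover : compact [set: M] -> exists L, chart_cover L.
Proof.
move=> cM; pose I := seq (midx M * set 'rV[R]_n).
pose cpt (L : I) := forall c, List.In c L -> chart_compacts c.1 c.2.
pose F : set_system I := filter_from [set L | cpt L]
  (fun L => [set L' | cpt L' -> forall c, List.In c L -> List.In c L']).
have FF : Filter F.
  apply: filter_from_filter; first by exists [::] => c [].
  move=> L L' cL cL'; exists (L ++ L').
    by move=> c /(@List.in_app_or _ _ _ _)[/cL|/cL'].
  by move=> L'' /= LL; split=> /= cL'' c cLc; apply: LL => //;
    apply: List.in_or_app; [left|right].
have [|L cL LP] := (compact_near_coveringP _).1 cM I F
  (fun L p => cpt L -> exists2 c, List.In c L &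
    cdom (mchart c.1) p /\ nbhs (cmap (mchart c.1) p) c.2) FF; last first.
  exists L; split=> // p; exact: (LP L).
move=> p _; have [i ip] := chart_at p.
have [|K cK [r r0 rK]] := @chart_compact_nbhs i (cmap (mchart i) p); first by exists p.
exists (cdom (mchart i) `&` cmap (mchart i) @^-1` ball (cmap (mchart i) p) r,
  [set L | cpt L -> List.In (i, K) L]) => /=.
  split.
    apply: filterI; first exact: open_nbhs_nbhs (conj (cdom_open _) ip).
    have := @cmap_continuous _ _ (mchart i).
    rewrite continuous_open_subspace; last exact: cdom_open.
    by move=> /(_ p); rewrite inE => /(_ ip); apply; exact: nbhsx_ballx.
  exists [:: (i, K)]; first by move=> c [<-|[]].
  by move=> L LP cL; apply: LP => //; left.
move=> [q L] /= [[iq qr] LK] cL; exists (i, K); first exact: LK.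
split=> //=; apply: filterS rK _.
by apply: open_nbhs_nbhs; split=> //; exact: ball_open.
Qed.

End SectionTopology.

(** * A translation-invariant metric for the C^oo topology *)

Section SectionMetric.
Context {R : realType} {n : nat} (M : smooth_manifold R n).
Local Notation S := (sym2_section M).
Implicit Types (i j : midx M) (h g u : S) (s t : seq 'I_n).

Lemma form_at h i p (v w : tangent p) : cdom (mchart i) p ->
  Defs.form h v w = \sum_a \sum_b v i 0 a *
    (w i 0 b * section_jet i [::] h (cmap (mchart i) p) a b).
Proof.
move=> ip; have := form_coords h i (cmap (mchart i) p) (v i) (w i).
by rewrite /= cmapK ?inE// => <-; rewrite -!tangent_coord.
Qed.

Variables (L : seq (midx M * set 'rV[R]_n)) (coverL : chart_cover L).

(* Truncating each jet coordinate at a level that tends to 0 with its order and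
   taking a supremum, instead of summing a series, makes all balls absolutely
   convex. *)
Definition jet_values h : set R := [set y | exists c s x,
  [/\ List.In c L, c.2 x & y = Num.min (size s).+1%:R^-1 `|section_jet c.1 s h x|]].

Definition jet_gauge h : R := sup (jet_values h).

Lemma jet_gauge_le h r : 0 <= r -> (forall c s x, List.In c L -> c.2 x ->
  Num.min (size s).+1%:R^-1 `|section_jet c.1 s h x| <= r) -> jet_gauge h <= r.
Proof.
move=> r0 hr; rewrite /jet_gauge.
(* The supremum of the empty set is 0, which is where [0 <= r] enters. *)
have [->|/set0P ne] := eqVneq (jet_values h) set0; first by rewrite sup0.
by apply: ge_sup => // _ [c [s [x [Lc cx ->]]]]; exact: hr.
Qed.

Lemma le_jet_gauge h c s x : List.In c L -> c.2 x ->
  Num.min (size s).+1%:R^-1 `|section_jet c.1 s h x| <= jet_gauge h.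
Proof.
move=> Lc cx; apply: ub_le_sup; last by exists c, s, x.
(* Every truncation level is at most 1, so the values are bounded above. *)
exists 1 => _ [c' [s' [x' [_ _ ->]]]].
by rewrite ge_min invf_le1// ler1n.
Qed.

Lemma jet_gauge_ge0 h : 0 <= jet_gauge h.
Proof.
rewrite /jet_gauge; have [->|/set0P [y hy]] := eqVneq (jet_values h) set0.
  by rewrite sup0.
case: (hy) => c [s [x [Lc cx yE]]].
apply: le_trans (le_jet_gauge h s Lc cx).
by rewrite le_min invr_ge0 ler0n normr_ge0.
Qed.

Let in_image c x : List.In c L -> c.2 x -> chart_image c.1 x.
Proof. by move=> /coverL.1[_]; exact. Qed.

Lemma jet_gauge0 : jet_gauge 0 = 0.
Proof.
apply/le_anti; rewrite jet_gauge_ge0 andbT; apply: jet_gauge_le => // c s x Lc cx.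
by rewrite section_jet0 ?normr0 ?ge_min ?lexx ?orbT//; exact: in_image.
Qed.

Lemma jet_gauge_eq0 h : jet_gauge h = 0 -> h = 0.
Proof.
move=> h0; apply: sym2_section_eq => p v w.
have [c Lc [cp /nbhs_singleton nc]] := coverL.2 p.
rewrite !(form_at _ _ _ cp).
have -> : section_jet c.1 [::] h (cmap (mchart c.1) p) = 0.
  (* At order 0 the truncation level is 1, so a zero minimum means that the component matrix itself
     vanishes. *)
  have := le_jet_gauge h [::] Lc nc; rewrite h0 ge_min /= invr1.
  by rewrite leNgt ltr01/= normr_le0 => /eqP.
rewrite -(@section_jet0 _ _ _ c.1 [::] (cmap (mchart c.1) p))//.
exact: in_image.
Qed.

(** Truncation at a level [w] is monotone and commutes with maxima, so absolute convexity passes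
    from the norm to every term of the supremum. *)
Lemma jet_gauge_conv (a b : R) h g : `|a| + `|b| <= 1 ->
  jet_gauge (a *: h + b *: g) <= Num.max (jet_gauge h) (jet_gauge g).
Proof.
move=> ab; apply: jet_gauge_le => [|c s x Lc cx]; first by rewrite le_max jet_gauge_ge0.
have ix := in_image Lc cx.
rewrite section_jet_lincomb// section_jetZ//.
set X := section_jet _ _ h x; set Y := section_jet _ _ g x; set w := _^-1.
have := le_jet_gauge h s Lc cx; have := le_jet_gauge g s Lc cx; rewrite -/X -/Y -/w.
move=> Yg Xh; apply: (@le_trans _ _ (Num.max (Num.min w `|X|) (Num.min w `|Y|))).
  rewrite -min_maxr le_min ge_min lexx/= ge_min; apply/orP; right.
  set m := Num.max _ _.
  have Xm : `|X| <= m by rewrite le_max lexx.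
  have Ym : `|Y| <= m by rewrite le_max lexx orbT.
  have m0 : 0 <= m := le_trans (normr_ge0 _) Xm.
  rewrite (le_trans (ler_normD _ _))// !normrZ.
  rewrite (@le_trans _ _ ((`|a| + `|b|) * m))//; last by rewrite ler_piMl.
  by rewrite mulrDl lerD// ler_wpM2l.
by rewrite ge_max !le_max Xh Yg orbT.
Qed.

Lemma jet_gaugeN h : jet_gauge (- h) = jet_gauge h.
Proof.
have H u : jet_gauge (- u) <= jet_gauge u.
  have := @jet_gauge_conv (-1) 0 u u.
  by rewrite scaleN1r scale0r addr0 maxxx normrN1 normr0 addr0; exact.
by apply/le_anti; rewrite H -{1}[h]opprK H.
Qed.

(** Truncation at a nonnegative level is subadditive on nonnegative numbers. *)
Lemma jet_gaugeD h g : jet_gauge (h + g) <= jet_gauge h + jet_gauge g.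
Proof.
apply: jet_gauge_le => [|c s x Lc cx]; first by rewrite addr_ge0 ?jet_gauge_ge0.
rewrite section_jetD; last exact: in_image.
apply: le_trans (lerD (le_jet_gauge h s Lc cx) (le_jet_gauge g s Lc cx)).
set X := section_jet _ _ h x; set Y := section_jet _ _ g x; set w := _^-1.
have w0 : 0 <= w by rewrite invr_ge0.
have := ler_normD X Y; have := normr_ge0 X; have := normr_ge0 Y.
move: `|X + Y| `|X| `|Y| => z x' y' y0 x0 zxy.
rewrite ge_min; have [|] := leP w x'; have [|] := leP w y'; lra.
Qed.

(** The gauge controls uniform convergence in every chart. Near a point of [K] one passes to a chart
    of the cover, where [section_jet_bound] applies; compactness of [K] then gives a common [d]. *)
Lemma jet_gauge_small j s K (e : R) : chart_compacts j K -> 0 < e ->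
  exists2 d : R, 0 < d & forall u, jet_gauge u < d ->
    forall x, K x -> `|section_jet j s u x| < e.
Proof.
move=> [cK Kj] e0.
have : \forall d \near 0^'+, K `<=` (fun x => forall u, jet_gauge u < d ->
    `|section_jet j s u x| < e).
  apply: (compact_near_coveringP K).1 => // x0 Kx0.
  have [p jp px] := Kj _ Kx0; have [[i Ki] /= Lc [ip nKi]] := coverL.2 p.
  have Ox0 : overlap (mchart j) (mchart i) x0 by exists p.
  have [C HC] := section_jet_bound s Ox0.
  have w0 : 0 < ((size s).+1%:R^-1 : R) by rewrite invr_gt0.
  have eC0 : 0 < e / (`|C| + 1) by rewrite divr_gt0// ltr_wpDl.
  set phi := transition (mchart j) (mchart i) in HC.
  have nphi : \forall x \near x0, Ki (phi x).
    have : {for x0, continuous phi}.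
      exact: smooth_continuous (@mchart_smooth _ _ M j i) Ox0.
    by apply; rewrite /phi -px /transition/= cmapK ?inE.
  pose B := [set x | forall u (e : R),
    (forall t, (size t <= size s)%N -> `|section_jet i t u (phi x)| <= e) ->
    `|section_jet j s u x| <= C * e].
  exists ([set x | Ki (phi x)] `&` B,
    [set d : R | d < (size s).+1%:R^-1] `&` [set d : R | d < e / (`|C| + 1)]) => /=.
    split; first exact: (filterI nphi HC).
    by apply: filterI; apply: nbhs_right_lt.
  move=> [x d] /= [[Kx HCx] [dw dC]] u ud.
  apply: (@le_lt_trans _ _ (C * jet_gauge u)).
    apply: HCx => t ts.
    (* The gauge is below the truncation level of order [size s], hence below that of any shorter
       word, so the minimum must be the jet norm. *)
    have := le_jet_gauge u t Lc Kx; rewrite ge_min => /orP[|//] wt.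
    have := le_lt_trans wt (lt_trans ud dw).
    by rewrite ltf_pV2 ?posrE// ltr_nat ltnS ltnNge ts.
  apply: (@le_lt_trans _ _ ((`|C| + 1) * jet_gauge u)).
    by rewrite ler_wpM2r ?jet_gauge_ge0// (le_trans (ler_norm _))// lerDl.
  rewrite mulrC -ltr_pdivlMr; first exact: lt_trans ud dC.
  by rewrite ltr_wpDl.
move=> H; near (0 : R)^'+ => d.
exists d => [|u ud x Kx]; first by near: d; exact: nbhs_right_gt.
by move: u ud; move: x Kx; near: d.
Unshelve. all: by end_near. Qed.

Lemma near_list (T U : Type) (F : set_system T) (l : seq U) (A : U -> set T) :
  Filter F -> (forall c, List.In c l -> F (A c)) ->
  F [set x | forall c, List.In c l -> A c x].
Proof.
move=> FF; elim: l => [|c l IH] FA; first by apply: filterE => x c [].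
have Fl : F [set x | forall c, List.In c l -> A c x].
  by apply: IH => c' lc'; apply: FA; right.
apply: filterS2 (FA c (or_introl erefl)) Fl => x Ax lx c' [<-//|]; exact: lx.
Qed.

(** This is the converse comparison of topologies. Words of length at least [m] are truncated to at
    most [r / 2]; only finitely many shorter words and finitely many charts remain, and each imposes
    a condition that holds near [h]. *)
Lemma nbhs_jet_gauge h (r : R) : 0 < r -> \forall g \near h, jet_gauge (h - g) < r.
Proof.
move=> r0; have r20 : 0 < r / 2 by rewrite divr_gt0.
have [m mr] : exists m : nat, (m.+1%:R^-1 : R) <= r / 2.
  exists (Num.truncn (r / 2)^-1).
  rewrite -[leRHS]invrK lef_pV2 ?posrE ?invr_gt0//.
  exact/ltW/truncnS_gt.
pose A (c : midx M * set 'rV[R]_n) k (s : k.-tuple 'I_n) := [set g | forall x, c.2 x ->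
  `|section_jet c.1 s h x - section_jet c.1 s g x| < r / 2].
have : \forall g \near h, forall c, List.In c L ->
    forall (k : 'I_m) (s : k.-tuple 'I_n), A c k s g.
  apply: (@near_list _ _ (nbhs h) L (fun c => [set g |
    forall (k : 'I_m) (s : k.-tuple 'I_n), A c k s g])) => c Lc.
  apply: (@filter_forall _ _ (fun k : 'I_m => 
    [set g | forall s : k.-tuple 'I_n, A c k s g]) _ (nbhs_filter h)) => k.
  apply: (@filter_forall _ _ (fun s : k.-tuple 'I_n => A c k s) _ (nbhs_filter h)) => s.
  by apply: nbhs_section => //; exact: coverL.1.
apply: filterS => g Ag; apply: (@le_lt_trans _ _ (r / 2)); last first.
  by rewrite ltr_pdivrMr// ltr_pMr// ltr1n.
apply: jet_gauge_le => [|c s x Lc cx]; first exact: ltW.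
rewrite ge_min; have [sm|ms] := ltnP (size s) m; apply/orP; [right|left].
  rewrite section_jetB; last exact: in_image.
  exact/ltW/(Ag c Lc (Ordinal sm) (in_tuple s)).
by rewrite (le_trans _ mr)// lef_pV2 ?posrE// ler_nat.
Qed.

Lemma section_nbhsE h : nbhs h =
  filter_from [set e : R | 0 < e] (fun e => [set g | jet_gauge (h - g) < e]).
Proof.
pose G := filter_from [set e : R | 0 < e] (fun e => [set g | jet_gauge (h - g) < e]).
have FG : Filter G.
  apply: filter_from_filter; first by exists 1 => /=.
  move=> d e /= d0 e0; exists (Num.min d e); first by rewrite /= lt_min d0.
  by move=> g /=; rewrite lt_min => /andP[].
have Gh : G --> h.
  apply/cvg_sectionP => i s K cK e e0.
  have [d d0 dP] := jet_gauge_small s cK e0.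
  exists d => // g gd x Kx; rewrite -section_jetB; first exact: dP.
  exact: cK.2.
apply/seteqP; split=> [A|A [e /= e0 eA]]; first exact: Gh.
by apply: filterS eA _; exact: nbhs_jet_gauge.
Qed.

End SectionMetric.

(** * Completeness: the limit of a sequence with uniformly Cauchy jets *)

Section SectionLimit.
Context {R : realType} {n : nat} (M : smooth_manifold R n).
Local Notation S := (sym2_section M).
Implicit Types (i j : midx M) (s t : seq 'I_n).

Variable u : nat -> S.
Hypothesis u_cauchy : forall i s K, chart_compacts i K -> forall e : R, 0 < e ->
  exists N, forall k l, (N <= k)%N -> (N <= l)%N ->
    forall x, K x -> `|section_jet i s (u k) x - section_jet i s (u l) x| < e.

Definition limit_jet i s (x : 'rV[R]_n) : 'M[R]_n :=
  lim (section_jet i s (u k) x @[k --> \oo]).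

Lemma limit_jet_cvg i s x : chart_image i x ->
  section_jet i s (u k) x @[k --> \oo] --> limit_jet i s x.
Proof.
move=> ix; apply/cauchy_cvgP/cauchy_exP => e e0.
(* A singleton is compact, so the uniform Cauchy condition specializes to a pointwise one. *)
have cx : chart_compacts i [set x].
  by split=> [|y ->//]; exact: compact_set1.
have [N NP] := u_cauchy s cx e0.
exists (section_jet i s (u N) x); exists N => // k /= Nk.
by rewrite -ball_normE; exact: NP.
Qed.

Lemma limit_jet_entry_cvg i s x a b : chart_image i x ->
  section_jet i s (u k) x a b @[k --> \oo] --> limit_jet i s x a b.
Proof.
move=> ix; apply/cvgrPdist_lt => e e0.
have /cvgrPdist_lt /(_ _ e0) := @limit_jet_cvg i s _ ix; apply: filterS => k.
apply: le_lt_trans.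
by have := le_mx_norm (limit_jet i s x - section_jet i s (u k) x) a b; rewrite !mxE.
Qed.

Lemma limit_jet_unif i s K (e : R) : chart_compacts i K -> 0 < e ->
  exists N, forall k, (N <= k)%N ->
    forall x, K x -> `|limit_jet i s x - section_jet i s (u k) x| < e.
Proof.
move=> cK e0; have e20 : 0 < e / 2 by rewrite divr_gt0.
have [N NP] := u_cauchy s cK e20; exists N => k Nk x Kx.
have /cvgrPdist_lt /(_ _ e20)[N' _ N'P] := @limit_jet_cvg i s _ (cK.2 _ Kx).
(* The index [N'] depends on [x], but it serves only the intermediate term; the estimate holds from
   [N] on. *)
have mN' := N'P (maxn N N') (leq_maxr _ _).
rewrite -(subrKA (section_jet i s (u (maxn N N')) x)) [ltRHS]splitr.
rewrite (le_lt_trans (ler_normD _ _))// ltrD//.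
exact: NP (leq_maxl _ _) Nk _ Kx.
Qed.

Lemma limit_jet_near i s (x : 'rV[R]_n) (e : R) : chart_image i x -> 0 < e ->
  \forall y \near x & k \near \oo, `|limit_jet i s y - section_jet i s (u k) y| < e.
Proof.
move=> ix e0; have [K cK [r r0 rK]] := chart_compact_nbhs ix.
have [N NP] := limit_jet_unif s cK e0.
exists (ball x r, [set k | (N <= k)%N]) => /=.
  by split; [exact: nbhsx_ballx|exists N].
by move=> [y k] /= [/rK Ky Nk]; exact: NP.
Qed.

Lemma limit_jet_differentiable i s (x : 'rV[R]_n) : chart_image i x ->
  differentiable (limit_jet i s) x /\
  forall v, 'D_v (limit_jet i s) x = \sum_c v 0 c *: limit_jet i (c :: s) x.
Proof.
move=> ix; apply: (@unif_limit_differentiable _ _ _ _ (chart_image i)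
  (@open_chart_image _ _ _ i) (fun k => section_jet i s (u k)) _
  (fun c => limit_jet i (c :: s))) => //.
- by move=> k y; exact/smooth_differentiable/smooth_section_jet.
- move=> c k; exact: (smooth_continuous (smooth_section_jet i (c :: s) (u k))).
- by move=> y; exact: limit_jet_cvg.
- by move=> c e e0; exact: (limit_jet_near (c :: s)).
Qed.

(** The derivative in direction [v] is a linear combination of limit jets for words longer by one
    letter, so the induction on the order runs over all words at once. *)
Lemma smooth_limit_jet i s : smooth_on (chart_image i) (limit_jet i s).
Proof.
have oi := @open_chart_image _ _ _ i.
move=> k; elim: k s => [|k IH] s /=.
  rewrite continuous_open_subspace// => x; rewrite inE => ix.
  exact/differentiable_continuous/(limit_jet_differentiable s ix).1.
split=> [x ix|v]; first exact: (limit_jet_differentiable s ix).1.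
apply: Ck_ext (Ck_sum oi (fun c => v 0 c) (fun c => IH (c :: s))) => // x ix.
by rewrite (limit_jet_differentiable s ix).2.
Qed.

Lemma iter_partial_limit_jet i s x : chart_image i x ->
  iter_partial s (limit_jet i [::]) x = limit_jet i s x.
Proof.
elim: s x => //= c s IH x ix.
rewrite (eq_derive_open (@open_chart_image _ _ _ i) _ ix IH).
rewrite (limit_jet_differentiable s ix).2 (bigD1 c)//= big1 ?addr0.
  by rewrite mxE !eqxx scale1r.
by move=> d dc; rewrite mxE (negPf dc) andbF scale0r.
Qed.

Definition limit_form : form_field M :=
  fun p v w => lim (Defs.form (u k) v w @[k --> \oo]).

(** In a chart around [p] the values are finite combinations of convergent components. This gives
    existence of the limit, and linearity of the limit form is read off the formula. *)
Lemma limit_form_at i p (v w : tangent p) : cdom (mchart i) p ->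
  limit_form v w = \sum_a \sum_b v i 0 a *
    (w i 0 b * limit_jet i [::] (cmap (mchart i) p) a b).
Proof.
move=> ip; apply: cvg_lim => //.
under eq_cvg do rewrite (form_at _ _ _ ip).
have ix : chart_image i (cmap (mchart i) p) by exists p.
apply: (@cvg_big R^o _ +%R 0 xpredT); first exact: add_continuous.
move=> a _; apply: (@cvg_big R^o _ +%R 0 xpredT); first exact: add_continuous.
move=> b _; apply: cvgM; first exact: cvg_cst.
by apply: cvgM; [exact: cvg_cst|exact: limit_jet_entry_cvg].
Qed.

Lemma limit_form_sym p (v w : tangent p) : limit_form v w = limit_form w v.
Proof.
rewrite /limit_form (_ : (fun k => _) = (fun k => Defs.form (u k) w v))//.
by apply/funext => k; exact: form_sym.
Qed.

Lemma limit_form_linear p (v : tangent p) : linear (limit_form v : tangent p -> R^o).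
Proof.
move=> a w w'; have [i ip] := chart_at p; rewrite !(limit_form_at _ _ ip).
rewrite scaler_sumr -big_split/=; apply: eq_bigr => b _.
rewrite scaler_sumr -big_split/=; apply: eq_bigr => c _.
transitivity (v i 0 b * ((a * w i 0 c + w' i 0 c) *
    limit_jet i [::] (cmap (mchart i) p) b c)).
  by congr (_ * (_ * _)); rewrite -[LHS]/((a *: w i + w' i) 0 c) !mxE.
by rewrite -[a *: _]/(a * _); ring.
Qed.

Lemma limit_form_components i x : chart_image i x ->
  form_components limit_form i x = limit_jet i [::] x.
Proof.
move=> ix; apply/matrixP => k l; rewrite mxE; apply: cvg_lim => //.
have : section_jet i [::] (u m) x k l @[m --> \oo] --> limit_jet i [::] x k l.
  exact: limit_jet_entry_cvg.
by under eq_cvg do rewrite mxE.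
Qed.

Lemma limit_form_smooth i :
  smooth_on (cmap (mchart i) @` cdom (mchart i)) (form_components limit_form i).
Proof.
move=> k; apply: (@Ck_ext _ _ _ _ (@open_chart_image _ _ _ i) k (limit_jet i [::])).
  by move=> x ix; rewrite limit_form_components.
exact: smooth_limit_jet.
Qed.

Definition limit_section : S :=
  Sym2Section limit_form_sym limit_form_linear limit_form_smooth.

Lemma cvg_limit_section : u @ \oo --> limit_section.
Proof.
apply/cvg_sectionP => i s K cK e e0.
have [N NP] := limit_jet_unif s cK e0; exists N => // k /= Nk x Kx.
have ix := cK.2 _ Kx.
(* The jets of the limit tensor must be identified with the limits of the jets, which agree at order
   0 and have been shown to differentiate alike. *)
rewrite [section_jet i s limit_section x](_ : _ = limit_jet i s x); first exact: NP.
rewrite -iter_partial_limit_jet//.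
apply: (eq_iter_partial (@open_chart_image _ _ _ i)) ix => y iy.
exact: limit_form_components.
Qed.

End SectionLimit.

(** * The Frechet space of symmetric 2-tensors *)

Section SectionFrechet.
Context {R : realType} {n : nat} (M : smooth_manifold R n).
Variables (L : seq (midx M * set 'rV[R]_n)) (coverL : chart_cover L).
Local Notation S := (sym2_section M).

Definition section_dist (h g : S) : R := jet_gauge L (h - g).

Fact section_distxx h : section_dist h h = 0.
Proof. by rewrite /section_dist subrr jet_gauge0. Qed.

Fact section_dist_eq h g : section_dist h g = 0 -> h = g.
Proof. by move=> /(jet_gauge_eq0 coverL)/subr0_eq. Qed.

Fact section_dist_sym h g : section_dist h g = section_dist g h.
Proof. by rewrite /section_dist -jet_gaugeN// opprB. Qed.

Fact section_dist_triangle g h u :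
  section_dist h u <= section_dist h g + section_dist g u.
Proof. by rewrite /section_dist -(subrKA g) jet_gaugeD. Qed.

Fact section_distD2r u h g : section_dist (h + u) (g + u) = section_dist h g.
Proof. by rewrite /section_dist opprD addrACA subrr addr0. Qed.

Fact section_ball_convex (r : R) : absolutely_convex [set h | section_dist h 0 < r].
Proof.
move=> a b h g ab /=; rewrite /section_dist !subr0 => hr gr.
by rewrite (le_lt_trans (jet_gauge_conv coverL _ _ ab))// gt_max hr.
Qed.

Fact section_complete (u : nat -> S) :
  (forall e : R, 0 < e -> exists N, forall k l, (N <= k)%N -> (N <= l)%N ->
     section_dist (u k) (u l) < e) ->
  exists h : S, u @ \oo --> h.
Proof.
move=> uC.
have uJ i s K : chart_compacts i K -> forall e : R, 0 < e ->
    exists N, forall k l, (N <= k)%N -> (N <= l)%N ->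
    forall x, K x -> `|section_jet i s (u k) x - section_jet i s (u l) x| < e.
  move=> cK e e0; have [d d0 dP] := jet_gauge_small coverL s cK e0.
  have [N NP] := uC d d0; exists N => k l Nk Nl x Kx.
  rewrite -section_jetB; last exact: cK.2.
  exact: dP (NP _ _ Nk Nl) _ Kx.
exists (limit_section uJ); exact: cvg_limit_section.
Qed.

Definition section_frechet : frechet R :=
  @Frechet R S section_dist section_distxx section_dist_eq section_dist_sym
    section_dist_triangle section_distD2r section_ball_convex
    (section_nbhsE coverL) section_complete.

End SectionFrechet.

(** * Quadratic forms: continuity and lower bounds on the unit sphere *)

Section PositiveDefinite.
Context {R : realType} {n : nat}.
Implicit Types (A B : 'M[R]_n) (w : 'rV[R]_n).

Definition quad_form A w : R := \sum_a \sum_b w 0 a * (w 0 b * A a b).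

Lemma quad_formZ A w (c : R) : quad_form A (c *: w) = c ^+ 2 * quad_form A w.
Proof.
rewrite /quad_form mulr_sumr; apply: eq_bigr => a _.
by rewrite mulr_sumr; apply: eq_bigr => b _; rewrite !mxE; ring.
Qed.

Lemma quad_formB A B w : quad_form (A - B) w = quad_form A w - quad_form B w.
Proof.
rewrite /quad_form -sumrB; apply: eq_bigr => a _; rewrite -sumrB.
by apply: eq_bigr => b _; rewrite !mxE; ring.
Qed.

Lemma quad_form_le A w : `|w| <= 1 -> `|quad_form A w| <= (n * n)%:R * `|A|.
Proof.
move=> w1; have we a : `|w 0 a| <= 1 := le_trans (le_mx_norm w 0 a) w1.
apply: le_trans (ler_norm_sum _ _ _) _.
apply: (@le_trans _ _ (\sum_(a < n) \sum_(b < n) `|A|)); last first.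
  by rewrite !sumr_const card_ord -mulrnA mulr_natl lexx.
apply: ler_sum => a _; apply: le_trans (ler_norm_sum _ _ _) _.
apply: ler_sum => b _; rewrite !normrM.
rewrite -[leRHS]mul1r ler_pM ?mulr_ge0//.
by rewrite -[leRHS]mul1r ler_pM// le_mx_norm.
Qed.

Lemma quad_form_continuous (f : 'rV[R]_n -> 'M[R]_n) (z : 'rV[R]_n * 'rV[R]_n) :
  {for z.1, continuous f} ->
  {for z, continuous (fun z : 'rV[R]_n * 'rV[R]_n => quad_form (f z.1) z.2)}.
Proof.
move=> cf.
have c2 (a : 'I_n) :
    (fun z' : 'rV[R]_n * 'rV[R]_n => z'.2 0 a) @ z --> z.2 0 a.
  apply: (@continuous_comp _ _ _ (@snd _ _) (fun w : 'rV[R]_n => w 0 a) z).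
    exact: cvg_snd.
  exact: coord_continuous.
apply: (@cvg_big R^o _ +%R 0 xpredT); first exact: add_continuous.
move=> a _; apply: (@cvg_big R^o _ +%R 0 xpredT); first exact: add_continuous.
move=> b _; apply: cvgM; first exact: c2.
apply: cvgM; first exact: c2.
apply: (@continuous_comp _ _ _ (f \o fst) (fun A : 'M[R]_n => A a b) z).
  by apply: continuous_comp => //; exact: cvg_fst.
exact: coord_continuous.
Qed.

Lemma compact_sphere : compact [set w : 'rV[R]_n | `|w| = 1].
Proof.
apply: bounded_closed_compact.
  exists 1; split=> [|A A1 w /= ->]; first exact: num_real.
  exact: ltW.
apply: (@closed_comp _ _ (fun w : 'rV[R]_n => `|w|) [set 1]).
  by move=> w _; exact: norm_continuous.
exact: closed_eq.
Qed.

(** Near each point of [K] times the sphere the form exceeds half its value there, and compactness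
    of the product yields one positive bound. *)
Lemma quad_form_pos_lower_bound (f : 'rV[R]_n -> 'M[R]_n) (K : set 'rV[R]_n) :
  compact K -> (forall x, K x -> {for x, continuous f}) ->
  (forall x w, K x -> w != 0 -> 0 < quad_form (f x) w) ->
  exists2 d : R, 0 < d & forall x w, K x -> `|w| = 1 -> d < quad_form (f x) w.
Proof.
move=> cK fc fpos.
have : \forall d \near 0^'+, K `*` [set w | `|w| = 1] `<=`
    (fun z => d < quad_form (f z.1) z.2).
  apply: (compact_near_coveringP _).1 => [|z [/= Kz z1]].
    by apply: compact_setX => //; exact: compact_sphere.
  have q0 : 0 < quad_form (f z.1) z.2.
    by apply: fpos => //; rewrite -normr_eq0 z1 oner_eq0.
  set q := quad_form _ _ in q0; have q20 : 0 < q / 2 by rewrite divr_gt0.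
  have /continuous_normP /(_ _ q20) nz := quad_form_continuous (fc _ Kz).
  exists ([set z' | `|q - quad_form (f z'.1) z'.2| < q / 2], [set d | d < q / 2]) => /=.
    by split=> //; exact: nbhs_right_lt.
  move=> [z' d] /= [+ dq]; rewrite ltr_norml => /andP[_ H].
  by move: H dq; lra.
move=> H; near (0 : R)^'+ => d.
exists d => [|x w Kx w1]; first by near: d; exact: nbhs_right_gt.
suff : K `*` [set w | `|w| = 1] `<=` (fun z => d < quad_form (f z.1) z.2).
  by move=> /(_ (x, w)); exact.
by near: d.
Unshelve. all: by end_near. Qed.

End PositiveDefinite.

(** * Openness of positive definiteness *)

Section MetricsOpen.
Context {R : realType} {n : nat} (M : smooth_manifold R n).
Local Notation S := (sym2_section M).

(** Positivity over the finitely many compacts of a chart cover already implies positivity at every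
    point of [M], and over each of them it survives a small change of the components. *)
Lemma open_riemannian_metrics : compact [set: M] -> open (riemannian_metrics M).
Proof.
move=> /finite_chart_cover[L coverL]; rewrite openE => g gpos.
pose A c := [set h : S | forall x w, c.2 x -> w != 0 ->
  0 < quad_form (section_jet c.1 [::] h x) w].
have : \forall h \near g, forall c, List.In c L -> A c h.
  apply: (@near_list _ _ (nbhs g)) => -[i K] Lc.
  have cK : chart_compacts i K := coverL.1 _ Lc.
  have [|x w Kx w0|d d0 dP] := @quad_form_pos_lower_bound _ _
      (section_jet i [::] g) K cK.1.
  - by move=> x Kx; exact: smooth_continuous (smooth_section_jet _ _ _) (cK.2 _ Kx).
  - have [p ip px] := cK.2 _ Kx.
    have := gpos p (coord_vec i p w); rewrite (form_at _ _ _ ip) coord_vecE// px.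
    apply; apply: contra_neq w0 => cv0.
    by rewrite -(coord_vecE w ip) cv0.
  (* On unit vectors a form is at most [n * n] times the norm of its matrix, so a change below [e]
     costs at most [d], while the form of [g] exceeds [d] strictly. *)
  pose e := d / (n * n).+1%:R.
  have e0 : 0 < e by rewrite divr_gt0.
  apply: filterS (nbhs_section g [::] cK e0) => h gh x w /= Kx w0.
  have nw0 : 0 < `|w| by rewrite normr_gt0.
  (* Homogeneity of degree two reduces the claim to unit vectors. *)
  have -> : w = `|w| *: (`|w|^-1 *: w) by rewrite scalerA divff ?scale1r// gt_eqF.
  have w1 : `|(`|w|^-1 *: w)| = 1.
    by rewrite normrZ ger0_norm ?invr_ge0// mulVf// gt_eqF.
  rewrite quad_formZ mulr_gt0 ?exprn_gt0//; move: (_ *: w) w1 => {w0 nw0}w w1.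
  have := dP x w Kx w1.
  have := @quad_form_le _ _ (section_jet i [::] g x - section_jet i [::] h x) w.
  rewrite w1 lexx quad_formB ler_norml => /(_ isT)/andP[_].
  have : (n * n)%:R * `|section_jet i [::] g x - section_jet i [::] h x| <= d.
    apply: (@le_trans _ _ ((n * n).+1%:R * e)); last first.
      by rewrite /e mulrC divfK.
    by rewrite ler_pM// ?ler_nat//; exact/ltW/gh.
  by move: (quad_form _ _) (quad_form _ _) => a b; lra.
apply: filterS => h hA p v v0.
have [c Lc [cp /nbhs_singleton nc]] := coverL.2 p.
rewrite (form_at _ _ _ cp); apply: hA Lc _ _ nc _.
apply: contra_neq v0 => vc0; rewrite (tangent_coord v cp) vc0.
by have := coord_vec_linear c.1 p (-1) 0 0; rewrite scaler0 addr0 scaleN1r addNr.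
Qed.

End MetricsOpen.

Lemma hausdorff_set_type (X : topologicalType) (A : set X) :
  hausdorff_space X -> hausdorff_space A.
Proof.
move=> hX x y xy; apply: val_inj; apply: hX => B C nB nC.
have cv := @initial_continuous A X set_val.
by have [z []] := xy _ _ (cv x _ nB) (cv y _ nC); exists (set_val z).
Qed.

(** * The inclusion of an open subset as a global chart *)

Section InclusionChart.
Context {X : topologicalType} (A : set X) (a0 : A) (oA : open A).

(** The field [cinv] of a chart is a total map, so points outside [A] are sent to the base point
    [a0]. *)
Definition set_val_inv (y : X) : A :=
  if pselect (A y) is left Ay then exist _ y (mem_set Ay) else a0.

Lemma set_val_invK y : A y -> set_val (set_val_inv y) = y.
Proof. by rewrite /set_val_inv; case: pselect. Qed.

Lemma set_val_image : set_val @` [set: A] = A.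
Proof.
apply/seteqP; split=> [_ [x _ <-]|y Ay]; first exact: set_valP.
by exists (set_val_inv y) => //; exact: set_val_invK.
Qed.

Fact set_val_cancel : {in [set: A], cancel set_val set_val_inv}.
Proof.
by move=> x _; apply: val_inj; apply: set_val_invK; exact: set_valP.
Qed.

Fact set_val_within_continuous : {within [set: A], continuous (set_val : A -> X)}.
Proof. exact/continuous_subspaceT/initial_continuous. Qed.

Fact set_val_inv_continuous : {within set_val @` [set: A], continuous set_val_inv}.
Proof.
rewrite set_val_image continuous_open_subspace// => y; rewrite inE => Ay.
apply/initial_cvgP; rewrite set_val_invK//.
move=> B nB; apply: filterS2 nB (open_nbhs_nbhs (conj oA Ay)) => y' By' Ay' /=.
by rewrite set_val_invK.
Qed.

Fact set_val_image_open : open (set_val @` [set: A]).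
Proof. by rewrite set_val_image. Qed.

Definition inclusion_chart : chart A X :=
  Chart openT set_val_image_open set_val_cancel
    set_val_within_continuous set_val_inv_continuous.

End InclusionChart.

Theorem corollary1p1 (R : realType) (n : nat) (M : smooth_manifold R n)
    (compactM : compact [set: M]) (connectedM : connected [set: M])
    (g0 : riemannian_metrics M) :
  exists A : frechet_atlas R (riemannian_metrics M),
    bounded_frechet_manifold A /\ MC_frechet_manifold None A.
Proof.
have [L coverL] := finite_chart_cover compactM.
have oM := open_riemannian_metrics compactM.
(* The atlas has a single chart, the inclusion into [E]; the given metric [g0] is the default value
   of its inverse. *)
pose E := section_frechet coverL.
pose c : chart (riemannian_metrics M) E := inclusion_chart g0 oM.
pose A := @FrechetAtlas R (riemannian_metrics M) unit (fun=> E) (fun=> c).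
suff H : MC_frechet_manifold None A by exists A; split=> //; exists None.
split=> //.
- exact/hausdorff_set_type/(@frechet_hausdorff R E).
- by apply/seteqP; split=> // x _; exists tt.
(* The only transition map is that of [c] with itself, which is the identity on the image of the
   chart. *)
- move=> i j k; apply: (@lipHom_MC _ _ _ _ _ (id_lipHom E)).
    by rewrite /overlap setIT; exact: cimage_open.
  by move=> _ [x _ <-]; rewrite /transition /comp cmapK ?inE.
Qed.
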